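(* Let $F$ be admissible on $I=[0,a)$ with $a\in(0,\infty]$, let $\Omega$ be a smooth, bounded, and convex domain in $\mathbb{R}^n$, and $T\in(0,\infty]$. Assume that $\lim_{r\to+0}F(r)=-\infty$, $F\in C^2((0,a))$, $F'>0$ in $(0,a)$, and that for any $\theta\in\mathbb{R}^n$ and $t\in(0,T)$ the function $$\mathcal{H}_{\theta,t}(x,z,M):=\operatorname{trace}(A(x,t)M)+\frac{\mathcal{G}(x,t,f_F(z),f_F'(z)\theta)}{f_F'(z)}+\left(\frac{f_F''(z)}{f_F'(z)}-1\right)\langle A(x,t)\theta,\theta\rangle$$ is concave with respect to $(x,z,M)\in\Omega\times J_F\times\mathrm{Sym}(n)$, where $A(x,t):=(a^{ij}(x,t))$. Assume also that the following comparison principle (WCP) holds: if $v,w\in C(\overline{\Omega}\times[0,T))$ are a classical solution and a viscosity subsolution of problem (N) (defined in the context), respectively, such that $v\ge w$ on $\overline{\Omega}\times\{0\}$ and $v=w=0$ on $\partial\Omega\times[0,T)$, then $v\ge w$ in $\overline{\Omega}\times[0,T)$. Let $u$ be a classical solution of problem (N) with initial datum $\phi\in\mathcal{C}_\Omega[F]\cap BC_0(\overline{\Omega})$ such that $u(\cdot,t)\in\mathcal{A}_\Omega(I)$ for $t\in[0,T)$. Then $$u(\cdot,t)\in\mathcal{C}_\Omega[F]\quad\text{for all }t\in[0,T).$$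
   Context: **$F$-concavity.** $F:I\to[-\infty,\infty)$ is *admissible* on $I=[0,a)$ if $F$ is continuous on $(0,a)$, strictly increasing on $I$, and $F(0)=-\infty$. $J_F:=F((0,a))$, $f_F:J_F\to(0,a)$ is the inverse of $F|_{(0,a)}$. $\mathcal{A}_\Omega(I)$ is the set of functions $f:\Omega\to\mathbb{R}$ with $f(\Omega)\subset I$. $f\in\mathcal{A}_\Omega(I)$ is *$F$-concave* in $\Omega$ if $F(f((1-\lambda)x+\lambda y))\ge(1-\lambda)F(f(x))+\lambda F(f(y))$ for all $x,y\in\Omega$, $\lambda\in(0,1)$, with the conventions $-\infty\le-\infty$, $-\infty+b=-\infty$ for $b\in[-\infty,\infty)$, $\kappa\cdot(-\infty)=-\infty$ for $\kappa>0$. $\mathcal{C}_\Omega[F]$ is the set of $F$-concave functions in $\Omega$. $\mathrm{Sym}(n)$ is the space of real symmetric $n\times n$ matrices. $BC_0(\overline{\Omega})$: bounded continuous functions on $\overline{\Omega}$ vanishing on $\partial\Omega$. **Problem (N).** $$\begin{cases} \partial_t u=\sum_{i,j=1}^n a^{ij}(x,t)\partial_{x_i}\partial_{x_j}u+\mathcal{G}(x,t,u,\nabla u)&\text{in }\Omega\times(0,T),\\ u>0&\text{in }\Omega\times(0,T),\\ u=0&\text{on }\partial\Omega\times[0,T),\\ u(\cdot,0)=\phi\ge0&\text{in }\Omega, \end{cases}$$ where $a^{ij}$ are bounded and continuous on $\Omega\times[0,T)$, $A(x,t)=(a^{ij}(x,t))$ is symmetric and there is $\Lambda>0$ with $\Lambda^{-1}|\xi|^2\le\langle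 A(x,t)\xi,\xi\rangle\le\Lambda|\xi|^2$ for all $\xi\in\mathbb{R}^n$ and $(x,t)\in\Omega\times[0,T)$, and $\mathcal{G}\in C(\Omega\times[0,T)\times(0,\infty)\times\mathbb{R}^n)$. A *classical solution* is a function $u\in C((\overline{\Omega}\times(0,T))\cup(\Omega\times[0,T)))$ with $u\in C^{2;1}(\Omega\times(0,T))$ (i.e. $u,\partial_{x_i}u,\partial_{x_i}\partial_{x_j}u,\partial_tu$ continuous in $\Omega\times(0,T)$) satisfying (N) pointwise. **Viscosity subsolution.** An upper semicontinuous $U$ in $\Omega\times(0,T)$ is a *viscosity subsolution* of (N) if for any $(\xi,\tau)\in\Omega\times(0,T)$ and any $\psi\in C^{2;1}(\Omega\times(0,T))$ with $\psi(\xi,\tau)=U(\xi,\tau)$ and $\psi\ge U$ in a neighborhood of $(\xi,\tau)$, one has $\partial_t\psi(\xi,\tau)\le\sum_{i,j}a^{ij}(\xi,\tau)(\partial_{x_i}\partial_{x_j}\psi)(\xi,\tau)+\mathcal{G}(\xi,\tau,\psi(\xi,\tau),\nabla\psi(\xi,\tau))$.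
   Formalization: The solution u is also assumed continuous on all of closure(Ω)×[0,T), including the corner ∂Ω×{0}; without this the claim fails (heat equation on (0,1), F=log, φ=0, u a sum of boundary derivatives of the Dirichlet heat kernel at both ends). *)

(* Defs.v *)
From mathcomp Require Import all_boot all_order all_algebra.
From mathcomp Require Import all_classical all_reals all_analysis.
Set Implicit Arguments.
Unset Strict Implicit.
Unset Printing Implicit Defensive.
Import Order.TTheory GRing.Theory Num.Theory.
Import numFieldNormedType.Exports.
Local Open Scope ring_scope.
Local Open Scope classical_set_scope.

Section Defs.
Context {R : realType} {n : nat}.
Implicit Types (a T : \bar R) (F : R -> \bar R).

(* R^n is 'rV[R]_n. Its library norm `|x| is the sup norm, which gives the usual
   topology; the Euclidean |x|^2 is dot x x. *)
Notation Rn := 'rV[R]_n.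

(* [0, b) and (0, b) for b in (0, +oo] *)
Definition Ico0 (b : \bar R) : set R := [set r | 0 <= r /\ (r%:E < b)%E].
Definition Ioo0 (b : \bar R) : set R := [set r | 0 < r /\ (r%:E < b)%E].

Definition dot (x y : Rn) : R := \sum_i x 0 i * y 0 i.

(* M acts on the row vector x as the usual M x acts on columns. *)
Definition mxact (M : 'M[R]_n) (x : Rn) : Rn := x *m M^T.

Definition bdry (Om : set Rn) : set Rn := closure Om `\` interior Om.

Definition pd (i : 'I_n) (g : Rn -> R) : Rn -> R :=
  fun x => 'D_(delta_mx 0 i) g x.

Definition grad (g : Rn -> R) (x : Rn) : Rn := \row_i pd i g x.

Definition iter_pd (s : seq 'I_n) (g : Rn -> R) : Rn -> R := foldr pd g s.

Definition smooth_on (V : set Rn) (g : Rn -> R) : Prop :=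
  forall (s : seq 'I_n) (x : Rn), V x ->
    {for x, continuous (iter_pd s g)} /\
    forall i, derivable (iter_pd s g) x (delta_mx 0 i).

(* Near each boundary point, Om is the negative set of a smooth function with
   nonvanishing gradient. *)
Definition smooth_boundary (Om : set Rn) : Prop :=
  forall p, bdry Om p -> exists (V : set Rn) (rho : Rn -> R),
    [/\ open V, V p, smooth_on V rho, grad rho p != 0 &
        Om `&` V = [set x | rho x < 0] `&` V].

Record smooth_bounded_convex_domain (Om : set Rn) : Prop := {
  dom_open : open Om ;
  dom_nonempty : Om !=set0 ;
  dom_connected : connected Om ;
  dom_smooth : smooth_boundary Om ;
  dom_bounded : bounded_set Om ;
  dom_convex : convex_set (Om : set (convex_lmodType Rn)) }.

(* F takes values in [-oo, +oo); only its values on [0, a) matter. *)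
Record admissible a F : Prop := {
  adm_lty : forall r, Ico0 a r -> (F r < +oo)%E ;
  adm_cont : {within Ioo0 a, continuous F} ;
  adm_incr : forall r s, Ico0 a r -> Ico0 a s -> r < s -> (F r < F s)%E ;
  adm_0 : F 0 = -oo%E }.

(* For an admissible F, the real-valued function fine \o F is F on (0, a). *)
Definition JF a F : set R := (fine \o F) @` Ioo0 a.
Definition fF a F : R -> R := pinv (Ioo0 a) (fine \o F).

Definition C2_on (D : set R) (g : R -> R) : Prop :=
  (forall r, D r -> derivable g r 1 /\ derivable g^`() r 1) /\
  {within D, continuous g^`(2)}.

Definition A_Omega (Om : set Rn) a : set (Rn -> R) :=
  [set f | f @` Om `<=` Ico0 a].

(* The arithmetic of \bar R agrees with the conventions -oo + b = -oo for
   b < +oo and k * -oo = -oo for k > 0. *)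
Definition C_Omega (Om : set Rn) a F : set (Rn -> R) :=
  [set f | A_Omega Om a f /\
    forall x y (l : R), Om x -> Om y -> 0 < l < 1 ->
      ((1 - l)%:E * F (f x) + l%:E * F (f y)
        <= F (f ((1 - l) *: x + l *: y)%R))%E].

Definition BC0 (Om : set Rn) : set (Rn -> R) :=
  [set f | [/\ exists C, forall x, closure Om x -> `|f x| <= C,
               {within closure Om, continuous f} &
               forall x, bdry Om x -> f x = 0]].

Definition C21 (Om : set Rn) T (u : Rn -> R -> R) : Prop :=
  let Q := Om `*` Ioo0 T in
  [/\ forall x t, Om x -> Ioo0 T t ->
        [/\ forall i, derivable (u^~ t) x (delta_mx 0 i),
            forall i j, derivable (pd j (u^~ t)) x (delta_mx 0 i) &
            derivable (u x) t 1],
      {within Q, continuous (fun p => u p.1 p.2)},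
      forall i, {within Q, continuous (fun p => pd i (u^~ p.2) p.1)},
      forall i j, {within Q, continuous (fun p => pd i (pd j (u^~ p.2)) p.1)} &
      {within Q, continuous (fun p => (u p.1)^`() p.2)}].

Section Problem.
Variables (Om : set Rn) (T : \bar R).
(* A x t is the matrix (a^{ij}(x,t)); G is the nonlinearity, whose values
   G x t z p are meaningful only for z > 0. *)
Variables (A : Rn -> R -> 'M[R]_n) (G : Rn -> R -> R -> Rn -> R).

Record coefficients_ok : Prop := {
  coef_cont : forall i j,
    {within Om `*` Ico0 T, continuous (fun p => A p.1 p.2 i j)} ;
  coef_bounded : forall i j, exists C,
    forall x t, Om x -> Ico0 T t -> `|A x t i j| <= C ;
  coef_sym : forall x t, Om x -> Ico0 T t -> (A x t)^T = A x t ;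
  coef_elliptic : exists2 L : R, 0 < L & forall x t (xi : Rn),
    Om x -> Ico0 T t ->
    L^-1 * dot xi xi <= dot (mxact (A x t) xi) xi <= L * dot xi xi }.

Definition nonlinearity_ok : Prop :=
  {within [set q : Rn * R * R * Rn |
             [/\ Om q.1.1.1, Ico0 T q.1.1.2 & 0 < q.1.2]],
    continuous (fun q => G q.1.1.1 q.1.1.2 q.1.2 q.2)}.

(* Right-hand side of the equation applied to u at (x, t). *)
Definition rhsN (u : Rn -> R -> R) (x : Rn) (t : R) : R :=
  \sum_i \sum_j A x t i j * pd i (pd j (u^~ t)) x
    + G x t (u x t) (grad (u^~ t) x).

(* No continuity is required at the corner bdry Om `*` [set 0]: continuity on
   closure Om `*` [0, T) is a separate hypothesis wherever it is needed. *)
Record classical_solution (phi : Rn -> R) (u : Rn -> R -> R) : Prop := {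
  sol_cont : {within (closure Om `*` Ioo0 T) `|` (Om `*` Ico0 T),
                continuous (fun p => u p.1 p.2)} ;
  sol_C21 : C21 Om T u ;
  sol_eq : forall x t, Om x -> Ioo0 T t -> (u x)^`() t = rhsN u x t ;
  sol_gt0 : forall x t, Om x -> Ioo0 T t -> 0 < u x t ;
  sol_bdry : forall x t, bdry Om x -> Ico0 T t -> u x t = 0 ;
  sol_init : forall x, Om x -> u x 0 = phi x ;
  sol_init_ge0 : forall x, Om x -> 0 <= phi x }.

(* Positivity is part of the notion, since G is only given for z > 0. *)
Record viscosity_subsolution (U : Rn -> R -> R) : Prop := {
  visc_gt0 : forall x t, Om x -> Ioo0 T t -> 0 < U x t ;
  visc_usc : forall x t, Om x -> Ioo0 T t -> forall c, U x t < c ->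
    \forall q \near within (Om `*` Ioo0 T) (nbhs (x, t)), U q.1 q.2 < c ;
  visc_sub : forall xi tau (psi : Rn -> R -> R), Om xi -> Ioo0 T tau ->
    C21 Om T psi -> psi xi tau = U xi tau ->
    (\forall q \near within (Om `*` Ioo0 T) (nbhs (xi, tau)),
        U q.1 q.2 <= psi q.1 q.2) ->
    (psi xi)^`() tau <= rhsN psi xi tau }.

Definition WCP : Prop := forall (phi : Rn -> R) (v w : Rn -> R -> R),
  {within closure Om `*` Ico0 T, continuous (fun p => v p.1 p.2)} ->
  {within closure Om `*` Ico0 T, continuous (fun p => w p.1 p.2)} ->
  classical_solution phi v ->
  viscosity_subsolution w ->
  (forall x, closure Om x -> w x 0 <= v x 0) ->
  (forall x t, bdry Om x -> Ico0 T t -> v x t = 0 /\ w x t = 0) ->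
  forall x t, closure Om x -> Ico0 T t -> w x t <= v x t.

Definition calH a F (theta : Rn) (t : R) (p : Rn * R^o * 'M[R]_n) : R :=
  let x := p.1.1 in let z := p.1.2 in let M := p.2 in
  let f := fF a F in let f1 := f^`() in let f2 := f^`(2) in
  \tr (A x t *m M)
    + G x t (f z) (f1 z *: theta) / f1 z
    + (f2 z / f1 z - 1) * dot (mxact (A x t) theta) theta.

End Problem.

Definition concave_on (E : lmodType R) (D : set E) (h : E -> R) : Prop :=
  convex_function (D : set (convex_lmodType E)) (fun e => - h e).

Definition domH (Om : set Rn) a F : set (Rn * R^o * 'M[R]_n) :=
  [set p | [/\ Om p.1.1, JF a F p.1.2 & p.2^T = p.2]].

End Defs.

(* Main.v *)
(* Fix l in (0, 1) and let w(x, t) be the supremum of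
   f_F((1 - l) F(u(y, t)) + l F(u(z, t))) over all y, z in the closure of Om with
   x = (1 - l) y + l z. The assertion says that w <= u for every l. The function w
   is continuous, vanishes on the boundary and satisfies w <= u at time 0, since
   phi is F-concave; by the comparison principle it is enough that w is a
   viscosity subsolution. If a test function psi touches w from above at
   (xi, tau), and y, z realize the supremum there, then
     F(psi((1 - l) y' + l z', t)) >= (1 - l) F(u(y', t)) + l F(u(z', t))
   near (y, z, tau), with equality at that point. To first order F(u) has at y
   and z the same gradient theta as F(psi) at xi, and the time derivatives satisfy
   the corresponding identity; to second order, translating y and z in parallel,
   D^2 F(psi) >= (1 - l) D^2 F(u)(y) + l D^2 F(u)(z). Concavity of H_{theta, tau},
   its monotonicity in M and the equations at y and z give the inequality for
   psi. *)

Require Import Defs.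
From mathcomp Require Import all_boot all_order all_algebra.
From mathcomp Require Import ring lra.
From mathcomp Require Import all_classical all_reals all_analysis.
Set Implicit Arguments.
Unset Strict Implicit.
Import Order.TTheory GRing.Theory Num.Theory.
Import numFieldNormedType.Exports.
Local Open Scope ring_scope.
Local Open Scope classical_set_scope.

(** * Derivatives along lines *)

Lemma near_normP {R : realType} {V : normedModType R} (x : V) (P : set V) :
  (\forall y \near x, P y) <->
  exists2 r : R, 0 < r & forall y, `|y - x| < r -> P y.
Proof.
split=> [/nbhs_normP[r /= r0 xr]|[r r0 xr]].
  by exists r => // y yx; apply: xr; rewrite /= distrC.
by apply/nbhs_normP; exists r => //= y; rewrite /= distrC => /xr.
Qed.

Lemma near_line {R : realType} {V : normedModType R} (x v : V) (P : set V) :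
  (\forall y \near x, P y) -> \forall s \near (0 : R), P (x + s *: v).
Proof.
have : (x + s *: v) @[s --> (0 : R)] --> x + (0 : R) *: v.
  by apply: cvgD; [exact: cvg_cst | apply: cvgZ; [exact: cvg_id|exact: cvg_cst]].
by rewrite scale0r addr0; apply.
Qed.

Lemma continuous_comp2 {X Y Z W : topologicalType} (f : X -> Y) (g : X -> Z)
    (h : Y -> Z -> W) (x : X) :
  {for x, continuous f} -> {for x, continuous g} ->
  {for (f x, g x), continuous (fun p => h p.1 p.2)} ->
  {for x, continuous (fun x => h (f x) (g x))}.
Proof.
move=> cf cg ch.
apply: (@continuous_comp _ _ _ (fun x => (f x, g x)) (fun p => h p.1 p.2)) => //.
exact: cvg_pair.
Qed.

Lemma continuous_uncurryr {X Y Z : topologicalType} (h : X -> Y -> Z) x y :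
  {for (x, y), continuous (fun p => h p.1 p.2)} -> {for y, continuous (h x)}.
Proof.
move=> ch; apply: (@continuous_comp _ _ _ (fun y => (x, y)) (fun p => h p.1 p.2)).
  by apply: cvg_pair; [exact: cvg_cst | exact: cvg_id].
exact: ch.
Qed.

Lemma continuous_curryl {X Y Z : topologicalType} (h : X -> Y -> Z) x y :
  {for (x, y), continuous (fun p => h p.1 p.2)} -> {for x, continuous (h^~ y)}.
Proof.
move=> ch; apply: (@continuous_comp _ _ _ (fun x => (x, y)) (fun p => h p.1 p.2)).
  by apply: cvg_pair; [exact: cvg_id | exact: cvg_cst].
exact: ch.
Qed.

Section DirectionalDerivatives.
Context {R : realType} {V : normedModType R}.
Implicit Types (g : V -> R) (x v w : V).

Lemma is_derive_cvgP g x v (d : R) : is_derive x v g d <->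
  h^-1 *: (g (h *: v + x) - g x) @[h --> 0^'] --> d.
Proof.
split=> [[gv <-]//|gd]; have dg : derivable g x v by apply/cvg_ex; exists d.
by apply: DeriveDef => //; apply: cvg_lim.
Qed.

Lemma is_derive_line g x v (s d : R) :
  is_derive (x + s *: v) v g d <-> is_derive s 1 (fun r => g (x + r *: v)) d.
Proof.
have E : (fun h => h^-1 *: ((g \o shift (x + s *: v)) (h *: v)
      - g (x + s *: v))) =
    (fun h => h^-1 *: (((fun r => g (x + r *: v)) \o shift s) (h *: (1 : R))
      - g (x + s *: v))).
  by apply/funext => h /=; rewrite [_%:A]mulr1 scalerDl addrCA.
split=> -[gv dg]; constructor; move: gv dg;
  by rewrite /derivable /derive E.
Qed.

Lemma is_deriveZv g x v (c d : R) :
  is_derive x v g d -> is_derive x (c *: v) g (c * d).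
Proof.
rewrite -[in X in X -> _](addr0 x) -[in X in X -> _](scale0r v).
move=> /is_derive_line dg; have : is_derive (0 : R) 1 ( *%R c) c.
  by apply: is_derive_eq; rewrite [LHS]mulr1.
move: dg; rewrite -{1}(mulr0 c) => /is_derive1_comp /[apply].
rewrite (_ : _ \o _ = fun r => g (x + r *: (c *: v))); last first.
  by apply/funext => r /=; rewrite scalerA [r * c]mulrC.
by move/is_derive_line; rewrite scale0r addr0 mulrC.
Qed.

(** The intermediate point is given as a fraction [s] of [c], so that [c] may have either sign. *)
Lemma MVT_line g x v (c : R) :
  (forall s : R, 0 <= s <= 1 -> derivable g (x + (s * c) *: v) v) ->
  exists2 s : R, 0 <= s <= 1 &
    g (x + c *: v) - g x = c * 'D_v g (x + (s * c) *: v).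
Proof.
move=> dg; pose k s := g (x + s *: (c *: v)).
have dk (s : R) : 0 <= s <= 1 -> is_derive s 1 k (c * 'D_v g (x + (s * c) *: v)).
  by move=> s01; apply/is_derive_line/is_deriveZv; rewrite scalerA;
    apply/derivableP/dg.
have [r||s s01] := @MVT_segment _ k
  (fun s => c * 'D_v g (x + (s * c) *: v)) 0 1 ler01 _ _.
- by rewrite in_itv/= => /andP[r0 r1]; apply: dk; rewrite !ltW.
- apply: derivable_within_continuous => r; rewrite in_itv/= => /dk dr.
  exact: ex_derive.
- rewrite subr0 mulr1 /k scale1r scale0r addr0 => ->; exists s => //.
Qed.

(** The increment along [w + c *: v] is an increment along [w] followed by one along [v]. The latter
    is controlled by the mean value theorem and the continuity of ['D_v g] at [x]. *)
Lemma is_deriveD_dir g x v w (c d : R) :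
  (\forall y \near x, derivable g y v) -> {for x, continuous ('D_v g)} ->
  is_derive x w g d -> is_derive x (w + c *: v) g (d + c * 'D_v g x).
Proof.
move=> dv cv /is_derive_cvgP gw; apply/is_derive_cvgP.
suff gv : h^-1 *: (g (h *: (w + c *: v) + x) - g (h *: w + x)) @[h --> 0^']
    --> c * 'D_v g x.
  rewrite (_ : (fun h => _) = fun h => h^-1 *: (g (h *: w + x) - g x) +
      h^-1 *: (g (h *: (w + c *: v) + x) - g (h *: w + x))).
    exact: cvgD.
  by apply/funext => h; rewrite -scalerDr [in RHS]addrC subrKA.
apply/cvgrPdist_lt => e e0.
(* The summand 1 keeps the divisor positive when [c = 0]. *)
have c1 : 0 < `|c| + 1 by rewrite ltr_wpDl.
have [r r0 xr] : exists2 r : R, 0 < r & forall y, `|y - x| < r ->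
    derivable g y v /\ `|'D_v g x - 'D_v g y| < e / (`|c| + 1).
  have : \forall y \near x, derivable g y v /\
      `|'D_v g x - 'D_v g y| < e / (`|c| + 1).
    by apply: filterI => //; move/cvgrPdist_lt: cv; apply; rewrite divr_gt0.
  by move/near_normP.
near=> h.
have h0 : h != 0 by near: h; exact: nbhs_dnbhs_neq.
have hr (s : R) : 0 <= s <= 1 ->
    `|h *: w + x + (s * (h * c)) *: v - x| < r.
  move=> /andP[s0 s1]; rewrite addrAC addrK (le_lt_trans (ler_normD _ _))//.
  rewrite !normrZ (ger0_norm s0).
  have : `|h| * (`|w| + `|c| * `|v| + 1) < r.
    rewrite -ltr_pdivlMr ?ltr_wpDl ?addr_ge0 ?mulr_ge0//; near: h.
    by apply: dnbhs0_lt; rewrite divr_gt0 ?ltr_wpDl ?addr_ge0 ?mulr_ge0.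
  apply: le_lt_trans; rewrite mulrDr mulr1 ler_wpDr// mulrDr lerD2l.
  by rewrite -!mulrA ler_piMl ?mulr_ge0.
have [s s01] := MVT_line (fun s s01 => (xr _ (hr s s01)).1).
have -> : h *: (w + c *: v) + x = h *: w + x + (h * c) *: v.
  by rewrite scalerDr scalerA addrAC.
move=> ->; rewrite -mulrA scalerA mulVf// scale1r -mulrBr normrM.
have [_] := xr _ (hr s s01); rewrite ltr_pdivlMr//; apply: le_lt_trans.
by rewrite mulrC ler_wpM2l// lerDl.
Unshelve. all: by end_near. Qed.

End DirectionalDerivatives.

Section Partials.
Context {R : realType} {n : nat}.
Implicit Types (g : 'rV[R]_n -> R) (x v : 'rV[R]_n).

Definition C1_at g x := forall i,
  (\forall y \near x, derivable g y (delta_mx 0 i)) /\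
  {for x, continuous (pd i g)}.

(** The coordinate directions are added one at a time, each by [is_deriveD_dir]. *)
Lemma is_derive_pd g x v : C1_at g x ->
  is_derive x v g (\sum_i v 0 i * pd i g x).
Proof.
move=> g1; rewrite {1}(row_sum_delta v).
elim: (index_enum _) => [|i s IH]; rewrite ?big_nil ?big_cons.
  exact: is_derive0.
have [di ci] := g1 i.
rewrite addrC [X in is_derive _ _ _ X]addrC.
exact: is_deriveD_dir.
Qed.

End Partials.

(** * Chain rule and local minima in one variable *)

Lemma is_derive1_comp_derive1 {R : realType} (f g : R -> R) (x b : R) :
  derivable f (g x) 1 -> is_derive x 1 g b ->
  is_derive x 1 (fun s => f (g s)) (f^`()%classic (g x) * b).
Proof. by rewrite derive1E => /derivableP; exact: is_derive1_comp. Qed.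

Lemma is_derive_comb3 {R : realType} (f g h : R -> R) (x a b df dg dh : R) :
  is_derive x 1 f df -> is_derive x 1 g dg -> is_derive x 1 h dh ->
  is_derive x 1 (fun s => f s - a * g s - b * h s) (df - a * dg - b * dh).
Proof.
move=> Df Dg Dh.
exact: (is_deriveB (is_deriveB Df (is_deriveZ a Dg)) (is_deriveZ b Dh)).
Qed.

Lemma local_min_derive0 {R : realType} (k : R -> R) (x c : R) :
  is_derive x 1 k c -> (\forall s \near x, k x <= k s) -> c = 0.
Proof.
move=> /is_derive_cvgP dk /(@near_normP _ R^o)[r r0 kmin].
have kmin' h : `|h| < r -> 0 <= k (h *: 1 + x) - k x.
  by move=> hr; rewrite subr_ge0; apply: kmin; rewrite [_%:A]mulr1 addrK.
have [c0|c0|//] := ltgtP c 0.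
- have /cvgr_lt/(_ _ c0) := dk.
  rewrite near_withinE => /(@near_normP _ R^o)[d d0 Hd].
  pose s := Num.min d r / 2; have s0 : 0 < s by rewrite divr_gt0// lt_min d0.
  have sd : s < d by rewrite /s; case: (ltP d r) => ?; lra.
  have sr : s < r by rewrite /s; case: (ltP d r) => ?; lra.
  have := Hd s; rewrite subr0 gtr0_norm// => /(_ sd (lt0r_neq0 s0)).
  rewrite -[_ *: (_ - _)]/(_ * _) pmulr_rlt0 ?invr_gt0// ltNge kmin'//.
  by rewrite gtr0_norm.
- have /cvgr_gt/(_ _ c0) := dk.
  rewrite near_withinE => /(@near_normP _ R^o)[d d0 Hd].
  pose s := Num.min d r / 2; have s0 : 0 < s by rewrite divr_gt0// lt_min d0.
  have sd : s < d by rewrite /s; case: (ltP d r) => ?; lra.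
  have sr : s < r by rewrite /s; case: (ltP d r) => ?; lra.
  have := Hd (- s); rewrite subr0 normrN gtr0_norm// => /(_ sd).
  rewrite oppr_eq0 => /(_ (lt0r_neq0 s0)).
  rewrite -[_ *: (_ - _)]/(_ * _) nmulr_rgt0 ?invr_lt0 ?oppr_lt0//.
  by rewrite ltNge kmin'// normrN gtr0_norm.
Qed.

(** If [c < 0], then [k'] is negative just to the right of 0, and the mean value theorem yields a
    nearby [s] with [k s < k 0]. *)
Lemma local_min_second_order {R : realType} (k k' : R -> R) (c : R) :
  (\forall s \near (0 : R), is_derive (s : R) 1 k (k' s)) -> is_derive (0 : R) 1 k' c ->
  (\forall s \near (0 : R), k 0 <= k s) -> k' 0 = 0 /\ 0 <= c.
Proof.
move=> dk dk' kmin.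
have [r r0 H] : exists2 r : R, 0 < r & forall s : R, `|s| < r ->
    is_derive s 1 k (k' s) /\ k 0 <= k s.
  have [r r0 xr] := (@near_normP _ R^o _ _).1 (filterI dk kmin).
  by exists r => // y yx; apply: xr; rewrite subr0.
have k'0 : k' 0 = 0.
  by apply: local_min_derive0 kmin; exact: nbhs_singleton dk.
split=> //; rewrite leNgt; apply/negP => c0.
have /is_derive_cvgP/cvgr_lt/(_ _ c0) := dk'.
rewrite near_withinE => /(@near_normP _ R^o)[d d0 Hd].
pose s := Num.min d r / 2; have s0 : 0 < s by rewrite divr_gt0// lt_min d0.
have sd : s < d by rewrite /s; case: (ltP d r) => ?; lra.
have sr : s < r by rewrite /s; case: (ltP d r) => ?; lra.
have st (t : R) : 0 <= t <= s -> `|t| < r.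
  by move=> /andP[t0 ts]; rewrite ger0_norm// (le_lt_trans ts).
have [t||t] := @MVT _ k k' 0 s s0.
- rewrite in_itv/= => /andP[t0 ts]; apply: (H t _).1; apply: st.
  by rewrite !ltW.
- apply: derivable_within_continuous => t; rewrite in_itv/= => /st /H[] [].
  by [].
rewrite in_itv/= subr0 => /andP[t0 ts] kE.
have := (H s (st s _)).2; rewrite lexx ltW// => /(_ isT).
rewrite -subr_ge0 kE pmulr_lge0// leNgt => /negP; apply.
have := Hd t; rewrite subr0 ger0_norm ?ltW// (lt_trans ts)//.
move=> /(_ isT (lt0r_neq0 t0)); rewrite k'0 subr0 addr0 [_%:A]mulr1.
by rewrite -[_ *: _]/(_ * _) pmulr_rlt0 ?invr_gt0.
Qed.

Section SecondOrder.
Context {R : realType} {n : nat}.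
Implicit Types (F : R -> R) (g : 'rV[R]_n -> R) (x v : 'rV[R]_n).

Definition C2_at g x :=
  (\forall y \near x, C1_at g y) /\ forall j, C1_at (pd j g) x.

(** The chain-rule formula for the Hessian of [F \o g], with no symmetry in [i] and [j] built in. *)
Definition hess_comp F g x : 'M[R]_n :=
  let F1 := F^`() in let F2 := F1^`() in \matrix_(i, j)
  (F1 (g x) * pd i (pd j g) x + F2 (g x) * (pd i g x * pd j g x)).

Definition qform (M : 'M[R]_n) v := \sum_i \sum_j v 0 i * v 0 j * M i j.

Lemma is_derive_comp_line F g x v :
  C2_at g x -> (\forall r \near g x, derivable F r 1) ->
  derivable F^`()%classic (g x) 1 ->
  let k' s := F^`()%classic (g (x + s *: v)) * \sum_i v 0 i * pd i g (x + s *: v) in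
  (\forall s \near (0 : R), is_derive (s : R) 1 (fun s => F (g (x + s *: v))) (k' s))
  /\ is_derive (0 : R) 1 k' (qform (hess_comp F g x) v).
Proof.
move=> [g1 g2] dF ddF k'.
have dgl : \forall s \near (0 : R), is_derive (s : R) 1 (fun s => g (x + s *: v))
    (\sum_i v 0 i * pd i g (x + s *: v)).
  apply: filterS (near_line v g1) => s gs.
  exact: (is_derive_line g x v s _).1 (is_derive_pd v gs).
have dgl0 := nbhs_singleton dgl.
have cg : {for (0 : R), continuous (fun s : R => g (x + s *: v))}.
  by apply/differentiable_continuous/derivable1_diffP; case: dgl0.
split.
  have dFl : \forall s \near (0 : R), derivable F (g (x + s *: v)) 1.
    by move: dF; rewrite -{1}[x]addr0 -{1}(scale0r v) => H; exact (cg _ H).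
  near=> s; have dFs : derivable F (g (x + s *: v)) 1 by near: s.
  apply: (is_derive1_comp_derive1 dFs).
  by near: s.
have dk1 : is_derive (0 : R) 1 (fun s => F^`()%classic (g (x + s *: v)))
   (F^`()^`()%classic (g x) * \sum_i v 0 i * pd i g x).
  have E0 : x + 0 *: v = x by rewrite scale0r addr0.
  have ddF0 : derivable F^`()%classic (g (x + 0 *: v)) 1 by rewrite E0.
  have := is_derive1_comp_derive1 ddF0 dgl0.
  by rewrite E0; exact: id.
have dk2 : is_derive (0 : R) 1 (fun s => \sum_i v 0 i * pd i g (x + s *: v))
  (\sum_i v 0 i * \sum_j v 0 j * pd j (pd i g) x).
  rewrite (_ : (fun s => _) = \sum_i (v 0 i *: (fun s => pd i g (x + s *: v)))); last first.
    by apply/funext => s; rewrite fct_sumE.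
  apply: is_derive_sum => i; apply: is_deriveZ.
  apply: (is_derive_line (pd i g) x v 0 _).1; rewrite scale0r addr0.
  exact: (is_derive_pd v (g2 i)).
have -> : qform (hess_comp F g x) v =
    F^`()%classic (g x) * (\sum_i v 0 i * \sum_j v 0 j * pd j (pd i g) x) +
    (\sum_i v 0 i * pd i g x) *
      (F^`()^`()%classic (g x) * \sum_i v 0 i * pd i g x).
  (* The double sums are matched by renaming indices; the order of differentiation is never
     interchanged. *)
  rewrite /qform exchange_big mulr_suml mulr_sumr -big_split /=.
  apply: eq_bigr => i _; rewrite !mulr_sumr -big_split /=.
  by apply: eq_bigr => j _; rewrite mxE; ring.
have E0 : x + 0 *: v = x by rewrite scale0r addr0.
by have := is_deriveM dk1 dk2; rewrite !E0; exact: id.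
Unshelve. all: by end_near. Qed.

End SecondOrder.

(** * First- and second-order conditions at a touching point *)

Section Touching.
Context {R : realType} {n : nat}.
Implicit Types (F : R -> R) (p u : 'rV[R]_n -> R) (x y z v : 'rV[R]_n).

Definition twice_derivable_at F (r : R) :=
  (\forall s \near r, derivable F s 1) /\ derivable F^`() r 1.

Variables (F : R -> R) (p u : 'rV[R]_n -> R) (xi y z : 'rV[R]_n) (l : R).
Hypotheses (l01 : 0 < l < 1).
Hypotheses (p2 : C2_at p xi) (uy2 : C2_at u y) (uz2 : C2_at u z).
Hypotheses (Fp : twice_derivable_at F (p xi)).
Hypotheses (Fy : twice_derivable_at F (u y)) (Fz : twice_derivable_at F (u z)).
Hypothesis touch : F (p xi) = (1 - l) * F (u y) + l * F (u z).
Hypothesis above : forall v w : 'rV[R]_n, \forall s \near (0 : R),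
  (1 - l) * F (u (y + s *: v)) + l * F (u (z + s *: w)) <=
  F (p (xi + s *: ((1 - l) *: v + l *: w))).

Let dF (g : 'rV[R]_n -> R) x i : R := F^`()%classic (g x) * pd i g x.
Let dFv (g : 'rV[R]_n -> R) x v : R :=
  F^`()%classic (g x) * \sum_i v 0 i * pd i g x.

(** The difference of the two sides of [above] vanishes at [s = 0] by [touch] and is nonnegative
    nearby; these are its conditions for a local minimum. *)
Let above_derive (v w : 'rV[R]_n) :
  dFv p xi ((1 - l) *: v + l *: w) = (1 - l) * dFv u y v + l * dFv u z w /\
  0 <= qform (hess_comp F p xi) ((1 - l) *: v + l *: w)
       - (1 - l) * qform (hess_comp F u y) v - l * qform (hess_comp F u z) w.
Proof.
have [dp ddp] := is_derive_comp_line ((1 - l) *: v + l *: w) p2 Fp.1 Fp.2.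
have [dy ddy] := is_derive_comp_line v uy2 Fy.1 Fy.2.
have [dz ddz] := is_derive_comp_line w uz2 Fz.1 Fz.2.
set x := (1 - l) *: v + l *: w in dp ddp *.
pose k s := F (p (xi + s *: x)) - (1 - l) * F (u (y + s *: v))
  - l * F (u (z + s *: w)).
pose k' s := dFv p (xi + s *: x) x - (1 - l) * dFv u (y + s *: v) v
  - l * dFv u (z + s *: w) w.
have dk : \forall s \near (0 : R), is_derive (s : R) 1 k (k' s).
  near=> s; apply: is_derive_comb3; by near: s.
have dk' : is_derive (0 : R) 1 k' (qform (hess_comp F p xi) x -
    (1 - l) * qform (hess_comp F u y) v - l * qform (hess_comp F u z) w).
  exact: is_derive_comb3.
have [|k'0 k''0] := local_min_second_order dk dk'.
  apply: filterS (above v w) => s; rewrite /k !scale0r !addr0 touch.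
  by rewrite -/x => H; lra.
split=> //; move: k'0; rewrite /k' !scale0r !addr0 => H; lra.
Unshelve. all: by end_near. Qed.

Lemma touching_grad i : dF u y i = dF p xi i /\ dF u z i = dF p xi i.
Proof.
have dFv_delta g x (c : R) : dFv g x (c *: 'e_i) = c * dF g x i.
  rewrite /dFv /dF (bigD1 i)//= !mxE !eqxx mulr1 big1 ?addr0; last first.
    by move=> j ji; rewrite !mxE (negbTE ji) mulr0 mul0r.
  by rewrite mulrCA.
(* Moving [y] and [z] together makes the derivative at [xi] the weighted mean of those at [y] and
   [z]. *)
have [+ _] := above_derive (1 *: 'e_i) (1 *: 'e_i).
rewrite -scalerDl subrK scale1r !dFv_delta !mul1r => E2.
(* These displacements cancel in the convex combination: [xi] stays fixed, which forces the
   derivatives at [y] and [z] to agree. *)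
have [+ _] := above_derive (l *: 'e_i) (- (1 - l) *: 'e_i).
rewrite !scalerA -scalerDl !dFv_delta => E1.
have {E1}/eqP : l * (1 - l) * (dF u y i - dF u z i) = 0.
  by move: E1; rewrite mulrN [l * (1 - l)]mulrC subrr mul0r => E1; lra.
case/andP: l01 => l0 l1; rewrite !mulf_eq0 !subr_eq0 (gt_eqF l0) (gt_eqF l1)/=.
by move=> /eqP E1; move: E2; rewrite E1 => E2; split; lra.
Qed.

(** This is the second-order condition for the parallel translation of [y], [z] and hence [xi] by
    the same [v]. *)
Lemma touching_hess v : 0 <= qform (hess_comp F p xi) v
  - (1 - l) * qform (hess_comp F u y) v - l * qform (hess_comp F u z) v.
Proof.
by have [_] := above_derive v v; rewrite -scalerDl subrK scale1r.
Qed.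

End Touching.

(** * Positive definite matrices *)

(** A Cholesky factorization, by induction on the size: the first row and column are split off, and
    the Schur complement of the corner entry is again symmetric and positive definite. *)
Lemma posdef_decomp (R : rcfType) (n : nat) (A : 'M[R]_n) : A^T = A ->
  (forall v : 'rV[R]_n, v != 0 -> 0 < (v *m A *m v^T) 0 0) ->
  exists B : 'M[R]_n, A = B^T *m B.
Proof.
elim: n A => [|n IH] A; first by exists 0; rewrite [A]flatmx0 mulmx0.
move: A; rewrite -[n.+1]/(1 + n)%N => A symA posA.
pose a := A 0 0; pose b := ursubmx A; pose C := drsubmx A.
have defA : A = block_mx a%:M b b^T C.
  rewrite -[LHS](@submxK _ 1 n 1 n); congr block_mx.
    by rewrite [LHS]mx11_scalar !mxE !lshift0.
  by rewrite -[in LHS]symA -trmx_ursub.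
have qA (c : R) (w : 'rV[R]_n) :
    (row_mx c%:M w *m A *m (row_mx c%:M w)^T) 0 0 =
    c ^+ 2 * a + 2 * c * (b *m w^T) 0 0 + (w *m C *m w^T) 0 0.
  have wb : (w *m b^T) 0 0 = (b *m w^T) 0 0.
    by rewrite -[in LHS](trmxK w) -trmx_mul mxE.
  rewrite defA mul_row_block tr_row_mx mul_row_col !mulmxDl.
  rewrite !tr_scalar_mx !mul_scalar_mx !mul_mx_scalar.
  rewrite -scalemxAl.
  move: (w *m b^T) (b *m w^T) (w *m C *m w^T) wb => X Y Z E.
  by rewrite !mxE E eqxx mulr1n; ring.
have a0 : 0 < a.
  have := posA (row_mx 1%:M 0); rewrite qA !(mul0mx, trmx0, mulmx0) !mxE.
  rewrite mulr0 expr1n mul1r !addr0; apply.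
  apply/eqP => /matrixP/(_ 0 (lshift n 0)); rewrite row_mxEl !mxE => /eqP.
  by rewrite oner_eq0.
have symC : C^T = C.
  by rewrite /C trmx_drsub symA.
(* Schur complement *)
pose C' := C - a^-1 *: (b^T *m b).
have [||B' defC] := IH C'.
- by rewrite /C' linearB linearZ/= trmx_mul trmxK symC.
- move=> w w0.
  (* For fixed [w] this first coordinate minimizes the form of [A]; the minimum is the form of the
     Schur complement at [w]. *)
  have := posA (row_mx (- (a^-1 * (b *m w^T) 0 0))%:M w); rewrite qA.
  have -> : (w *m C' *m w^T) 0 0 = (w *m C *m w^T) 0 0 -
      a^-1 * (b *m w^T) 0 0 ^+ 2.
    rewrite /C' mulmxBr mulmxBl -scalemxAr -scalemxAl.
    have -> : w *m (b^T *m b) *m w^T = (b *m w^T)^T *m (b *m w^T).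
      by rewrite trmx_mul trmxK !mulmxA.
    move: (b *m w^T) (w *m C *m w^T) => X Y.
    by rewrite !mxE big_ord1 !mxE expr2.
  set t := (b *m w^T) 0 0.
  have -> : (- (a^-1 * t)) ^+ 2 * a + 2 * - (a^-1 * t) * t = - (a^-1 * t ^+ 2).
    by field; rewrite gt_eqF.
  rewrite addrC; apply; apply: contraNneq w0 => /(congr1 rsubmx).
  by rewrite row_mxKr linear0 => ->.
exists (block_mx (Num.sqrt a)%:M ((Num.sqrt a)^-1 *: b) 0 B').
rewrite tr_block_mx mulmx_block defA.
have sa : Num.sqrt a != 0 by rewrite gt_eqF// sqrtr_gt0.
rewrite !tr_scalar_mx !mul_scalar_mx !mul_mx_scalar !trmx0 !mul0mx !mulmx0.
rewrite !addr0 scalerA mulfV// scale1r linearZ/= scalerA mulfV// scale1r.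
congr block_mx.
  by rewrite scale_scalar_mx -expr2 sqr_sqrtr// ltW.
rewrite -defC -scalemxAl -scalemxAr scalerA -invfM -expr2 sqr_sqrtr ?ltW//.
by rewrite addrC subrK.
Qed.

(** With [A = B^T *m B] the trace is that of [B *m M *m B^T], whose diagonal entries are the values
    of the form of [M] at the rows of [B]. *)
Lemma trace_posdef_ge0 (R : rcfType) (n : nat) (A M : 'M[R]_n) : A^T = A ->
  (forall v : 'rV[R]_n, v != 0 -> 0 < (v *m A *m v^T) 0 0) ->
  (forall v : 'rV[R]_n, 0 <= (v *m M *m v^T) 0 0) -> 0 <= \tr (A *m M).
Proof.
move=> symA /(posdef_decomp symA)[B ->] Mge0.
rewrite -mulmxA mxtrace_mulC sumr_ge0// => i _.
have := Mge0 (row i B); rewrite -row_mul; congr (0 <= _).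
by rewrite !mxE; apply: eq_bigr => j _; rewrite !mxE.
Qed.

(** * Admissible functions and their means *)

Section Admissible.
Context {R : realType} (a : \bar R) (F : R -> \bar R).
Hypotheses (hF : admissible a F) (hF2 : C2_on (Ioo0 a) (fine \o F)).
Hypothesis hF' : forall r, Ioo0 a r -> 0 < (fine \o F)^`() r.
Hypothesis hF0 : F r @[r --> 0^'+] --> -oo%E.

Local Notation g := (fine \o F).

Lemma Ioo0_Ico0 (b : \bar R) : Ioo0 b `<=` Ico0 b.
Proof. by move=> r [r0 rb]; split => //; exact: ltW. Qed.

Lemma Ioo0_itv (b : \bar R) (r s m : R) :
  Ioo0 b r -> Ioo0 b s -> r <= m <= s -> Ioo0 b m.
Proof.
move=> [r0 _] [_ sb] /andP[rm ms]; split; first exact: lt_le_trans rm.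
by rewrite (le_lt_trans _ sb)// lee_fin.
Qed.

Lemma open_Ioo0 (b : \bar R) : open (Ioo0 b).
Proof.
have -> : Ioo0 b = [set r : R | 0 < r] `&` [set r | (r%:E < b)%E] by [].
by apply: openI; [exact: open_gt | exact: open_ereal_lt].
Qed.

(** [F r] is finite: admissibility keeps it below [+oo], and monotonicity above [F 0 = -oo]. *)
Lemma admE r : Ioo0 a r -> F r = (g r)%:E.
Proof.
move=> ar; have := adm_lty hF (Ioo0_Ico0 ar).
have : (F 0 < F r)%E.
  apply: (adm_incr hF) => //; last exact: ar.1; last exact: Ioo0_Ico0.
  by split=> //; case: ar => r0; apply: lt_trans; rewrite lte_fin.
by rewrite (adm_0 hF) /= ; case: (F r).
Qed.

Lemma adm_lt r s : Ioo0 a r -> Ioo0 a s -> (g r < g s) = (r < s).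
Proof.
have H x y : Ioo0 a x -> Ioo0 a y -> x < y -> g x < g y.
  move=> ax ay xy; rewrite -lte_fin -!admE//; apply: (adm_incr hF) => //;
    exact: Ioo0_Ico0.
move=> ar as_; case: (ltgtP r s) => [rs|sr|->]; rewrite ?ltxx//; first exact: H.
by apply/negbTE; rewrite -leNgt; apply/ltW/H.
Qed.

Lemma adm_le r s : Ioo0 a r -> Ioo0 a s -> (g r <= g s) = (r <= s).
Proof. by move=> ar as_; rewrite !leNgt adm_lt. Qed.

Lemma adm_inj r s : Ioo0 a r -> Ioo0 a s -> g r = g s -> r = s.
Proof.
by move=> ar as_ E; apply/eqP; rewrite eq_le -adm_le// -(adm_le as_)// E lexx.
Qed.

Lemma fFK r : Ioo0 a r -> fF a F (g r) = r.
Proof.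
move=> ar; apply: pinvKV; last by rewrite inE.
by move=> x y; rewrite !inE; exact: adm_inj.
Qed.

Lemma adm_near r : Ioo0 a r -> \forall s \near r, Ioo0 a s.
Proof. by move=> ar; apply: open_nbhs_nbhs; split=> //; exact: open_Ioo0. Qed.

Lemma adm_C2 r : Ioo0 a r -> twice_derivable_at g r.
Proof.
move=> ar; split; last by have [] := hF2.1 r ar.
by apply: filterS (adm_near ar) => s as_; have [] := hF2.1 s as_.
Qed.

Lemma adm_continuous r : Ioo0 a r -> {for r, continuous g}.
Proof.
move=> ar; apply/differentiable_continuous/derivable1_diffP.
by have [] := hF2.1 r ar.
Qed.

(** The intermediate value theorem applies when [r <= s]; otherwise the points are exchanged and [l]
    becomes [1 - l]. *)
Lemma adm_mean (l r s : R) : 0 < l < 1 -> Ioo0 a r -> Ioo0 a s ->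
  exists2 m, Ioo0 a m & g m = (1 - l) * g r + l * g s.
Proof.
move=> /andP[l0 l1].
have H x y (t : R) : 0 < t < 1 -> Ioo0 a x -> Ioo0 a y -> x <= y ->
    exists2 m, Ioo0 a m & g m = (1 - t) * g x + t * g y.
  move=> /andP[t0 t1] ax ay xy; have gxy : g x <= g y by rewrite adm_le.
  have [||m] := @IVT _ g x y ((1 - t) * g x + t * g y) xy.
  - apply: continuous_in_subspaceT => z; rewrite inE/= in_itv/= => xzy.
    by apply: adm_continuous; exact: Ioo0_itv xzy.
  - by rewrite min_l// max_r//; apply/andP; split; nra.
  - by rewrite in_itv/= => xmy gm; exists m => //; exact: Ioo0_itv xmy.
move=> ar as_; case: (leP r s) => [|/ltW] rs; first by apply: H; rewrite ?l0.
have [|m am gm] := H s r (1 - l) _ as_ ar rs; first by rewrite subr_gt0 l1 gtrBl.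
by exists m => //; rewrite gm; ring.
Qed.

(** Having the inversion on a whole neighbourhood of [g r] allows the formula for the first
    derivative of [fF] to be differentiated again. *)
Lemma adm_near_image r : Ioo0 a r -> \forall q \near g r,
  Ioo0 a (fF a F q) /\ g (fF a F q) = q.
Proof.
move=> ar.
have gc : {near r, continuous g}.
  by apply: filterS (adm_near ar); exact: adm_continuous.
have gK : {near r, cancel g (fF a F)}.
  by apply: filterS (adm_near ar); exact: fFK.
apply: filterI; last exact: near_continuous_can_sym gc gK.
have /nbhs_singleton := near_can_continuous gK gc.
by move/(_ (Ioo0 a)); apply; rewrite fFK//; exact: adm_near.
Qed.

Lemma is_derive_fF r : Ioo0 a r -> is_derive (g r) 1 (fF a F) (g^`()%classic r)^-1.
Proof.
move=> ar; apply: is_derive_inverse.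
- by apply: filterS (adm_near ar); exact: fFK.
- by apply: filterS (adm_near ar); exact: adm_continuous.
- by rewrite derive1E; apply/derivableP; have [] := hF2.1 r ar.
- by rewrite gt_eqF// hF'.
Qed.

Lemma fF_derive1 r : Ioo0 a r -> (fF a F)^`()%classic (g r) = (g^`()%classic r)^-1.
Proof. by move=> ar; rewrite [LHS]derive1E; case: (is_derive_fF ar). Qed.

Lemma fF_derive2 r : Ioo0 a r -> (fF a F)^`()^`()%classic (g r) =
  - g^`()^`()%classic r / g^`()%classic r ^+ 3.
Proof.
move=> ar; have E : \forall q \near g r,
    (g^`()%classic (fF a F q))^-1 = (fF a F)^`()%classic q.
  by apply: filterS (adm_near_image ar) => q [aq {2}<-]; rewrite fF_derive1.
have g'0 : g^`()%classic r != 0 by rewrite gt_eqF// hF'.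
have D : is_derive (g r) 1 (fun q => g^`()%classic (fF a F q))
    (g^`()^`()%classic r * (g^`()%classic r)^-1).
  have H := is_derive_fF ar.
  have d2 : derivable g^`()%classic (fF a F (g r)) 1.
    by rewrite fFK//; have [] := hF2.1 r ar.
  by have := is_derive1_comp_derive1 d2 H; rewrite fFK.
have DV := @is_deriveV _ (fun q => g^`()%classic (fF a F q)) (g r) _ 1 _ D.
move: DV; rewrite fFK// => /(_ g'0) /(near_eq_is_derive E) [_ DE].
by rewrite [LHS]derive1E [LHS]DE -[_ *: _]/(_ * _); field.
Qed.

End Admissible.

Section FMean.
Context {R : realType} (a : \bar R) (F : R -> \bar R).
Hypotheses (hF : admissible a F) (hF2 : C2_on (Ioo0 a) (fine \o F)).
Hypothesis hF' : forall r, Ioo0 a r -> 0 < (fine \o F)^`() r.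
Hypotheses (a0 : (0 < a)%E).
Hypothesis hF0 : F r @[r --> 0^'+] --> -oo%E.

Local Notation g := (fine \o F).

(* The value 0 stands for f_F(-oo). *)
Definition Fmean (l r s : R) : R :=
  if (0 < r) && (0 < s) then fF a F ((1 - l) * g r + l * g s) else 0.

Lemma Fmean_pos l r s : 0 < l < 1 -> Ioo0 a r -> Ioo0 a s ->
  Ioo0 a (Fmean l r s) /\ g (Fmean l r s) = (1 - l) * g r + l * g s.
Proof.
move=> l01 ar as_; have [m am gm] := adm_mean hF hF2 l01 ar as_.
by rewrite /Fmean ar.1 as_.1/= -gm fFK.
Qed.

Lemma Fmean_ge0 (l r s : R) : 0 < l < 1 -> (r%:E < a)%E -> (s%:E < a)%E ->
  0 <= Fmean l r s.
Proof.
move=> l01 ra sa; have [/andP[r0 s0]|rs] := boolP ((0 < r) && (0 < s)).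
  by have [[/ltW]] := Fmean_pos l01 (conj r0 ra) (conj s0 sa).
by rewrite /Fmean (negbTE rs).
Qed.

Lemma Fmean_gt0 (l r s : R) : 0 < Fmean l r s -> 0 < r /\ 0 < s.
Proof.
by rewrite /Fmean; case: ifPn => [/andP[]|]//; rewrite ltxx.
Qed.

Lemma Fmean_id l r : Ioo0 a r -> Fmean l r r = r.
Proof.
by move=> ar; rewrite /Fmean ar.1/= -mulrDl subrK mul1r fFK.
Qed.

Lemma FmeanC l r s : Fmean l r s = Fmean (1 - l) s r.
Proof. by rewrite /Fmean andbC addrC opprB addrCA subrr addr0. Qed.

(** As [d] tends to 0, [F d] tends to [-oo] and pulls the weighted sum with the fixed value at [s]
    below any level. This yields continuity of [Fmean] where an argument is not positive. *)
Lemma Fmean_small (l s e : R) : 0 < l < 1 -> Ioo0 a s -> 0 < e ->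
  exists2 d, Ioo0 a d & forall r' s', r' <= d -> s' <= s -> Fmean l r' s' < e.
Proof.
move=> l01 as_ e0; have /andP[l0 l1] := l01.
(* The minimum with [s] keeps the target level in [(0, a)], where values of [g] can be compared. *)
pose e' := Num.min e s; have e's : e' <= s by rewrite ge_min lexx orbT.
have e'0 : 0 < e' by rewrite lt_min e0 as_.1.
have ae' : Ioo0 a e' by split=> //; rewrite (le_lt_trans _ as_.2)// lee_fin.
(* The bound is the solution [q] of [(1 - l) * q + l * g s = g e']. *)
have Fc : \forall x \near (0 : R)^'+,
    (F x < ((g e' - l * g s) / (1 - l))%:E)%E by exact: cvgeNy_lt.
near (0 : R)^'+ => d.
have d0 : 0 < d by near: d; exact: nbhs_right_gt.
have ds : d < s by near: d; apply: nbhs_right_lt; case: as_.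
have ad : Ioo0 a d by split=> //; rewrite (lt_trans _ as_.2)// lte_fin.
have gd : (1 - l) * g d + l * g s < g e'.
  have : (F d < ((g e' - l * g s) / (1 - l))%:E)%E by near: d.
  by rewrite (admE hF ad) lte_fin ltr_pdivlMr ?subr_gt0//; lra.
exists d => // r' s' rd ss'.
have [/andP[r0 s0]|rs] := boolP ((0 < r') && (0 < s')); last first.
  by rewrite /Fmean (negbTE rs).
have ar' : Ioo0 a r' by split=> //; rewrite (le_lt_trans _ ad.2)// lee_fin.
have as' : Ioo0 a s' by split=> //; rewrite (le_lt_trans _ as_.2)// lee_fin.
have [am gm] := Fmean_pos l01 ar' as'.
apply: (@lt_le_trans _ _ e'); last by rewrite ge_min lexx.
rewrite -(adm_lt hF)// gm (le_lt_trans _ gd)// lerD// ler_pM2l ?subr_gt0//;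
  by rewrite (adm_le hF).
Unshelve. all: by end_near. Qed.

(** Where both arguments are positive this is a composition of continuous maps. Elsewhere the mean
    is 0 and is squeezed nearby by [Fmean_small]; [FmeanC] reduces to a nonpositive first
    argument. *)
Lemma Fmean_continuous (l r s : R) : 0 < l < 1 -> (r%:E < a)%E -> (s%:E < a)%E ->
  {for (r, s), continuous (fun p : R * R => Fmean l p.1 p.2)}.
Proof.
move=> l01 ra sa.
have lt_a (t : R) : (t%:E < a)%E -> \forall t' \near t, (t'%:E < a)%E.
  by move=> ta; apply: open_nbhs_nbhs; split=> //; exact: open_ereal_lt.
have small (k t t' e : R) : 0 < k < 1 -> (t%:E < a)%E ->
    (t'%:E < a)%E -> t <= 0 -> 0 < e -> exists P Q, [/\ nbhs t P, nbhs t' Q &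
    forall x y, P x -> Q y -> 0 <= Fmean k x y < e].
  move=> k01 ta t'a t0 e0.
  (* The bound [s1] is strictly above [t'], so that the points below it form a neighbourhood of
     [t']. *)
  have [s1 as1 ts1] : exists2 s1, Ioo0 a s1 & t' < s1.
    near (Num.max t' 0)^'+ => s1.
    have : Num.max t' 0 < s1 by near: s1; exact: nbhs_right_gt.
    rewrite gt_max => /andP[t's1 s10]; exists s1 => //; split=> //.
    near: s1; apply: cvg_within; apply: lt_a.
    by rewrite EFin_max gt_max t'a.
  have [d ad H] := Fmean_small k01 as1 e0.
  exists ([set x | (x%:E < a)%E] `&` [set x | x < d]).
  exists ([set y | (y%:E < a)%E] `&` [set y | y < s1]).
  split.
  - by apply: filterI; [exact: lt_a | apply: lt_nbhsl; case: ad => d0 _; lra].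
  - by apply: filterI; [exact: lt_a | exact: lt_nbhsl].
  - move=> x y [xa xd] [ya ys1]; rewrite Fmean_ge0// H// ltW//.
have [/andP[r0 s0]|rs0] := boolP ((0 < r) && (0 < s)).
  have ar : Ioo0 a r by [].
  have as_ : Ioo0 a s by [].
  have [m am gm] := adm_mean hF hF2 l01 ar as_.
  have cm : fF a F q @[q --> (1 - l) * g r + l * g s] --> Fmean l r s.
    rewrite /Fmean r0 s0/= -gm; apply/differentiable_continuous/derivable1_diffP.
    by case: (is_derive_fF hF hF2 hF' am).
  have cg : (1 - l) * g p.1 + l * g p.2 @[p --> (r, s)] -->
      (1 - l) * g r + l * g s.
    apply: cvgD; apply: cvgMr.
      apply: (@cvg_comp _ _ _ (fun p : R * R => p.1) g _ (nbhs r)).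
        exact: cvg_fst.
      exact: (adm_continuous hF2 ar).
    apply: (@cvg_comp _ _ _ (fun p : R * R => p.2) g _ (nbhs s)).
      exact: cvg_snd.
    exact: (adm_continuous hF2 as_).
  rewrite /continuous_at; apply: cvg_trans (cvg_comp _ _ cg cm).
  apply: near_eq_cvg.
  exists ([set x | 0 < x], [set y | 0 < y]).
    by split; exact: lt_nbhsr.
  by move=> -[x y] [/= x0 y0]; rewrite /Fmean x0 y0.
have M0 : Fmean l r s = 0 by rewrite /Fmean (negbTE rs0).
apply/cvgrPdist_lt => e e0; rewrite /= M0.
have [P [Q [nP nQ PQ]]] : exists P Q, [/\ nbhs r P, nbhs s Q &
    forall x y, P x -> Q y -> 0 <= Fmean l x y < e].
  move: rs0; rewrite negb_and -!leNgt => /orP[r0|s0].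
    by apply: small.
  have [|P [Q [nP nQ PQ]]] := small (1 - l) s r e _ sa ra s0 e0.
    by case/andP: l01; rewrite subr_gt0 gtrBl => -> ->.
  by exists Q, P; split=> // x y Qx Py; rewrite FmeanC PQ.
exists (P, Q) => // -[x y] [/= Px Qy].
by have /andP[m0 me] := PQ _ _ Px Qy; rewrite sub0r normrN ger0_norm.
Unshelve. all: by end_near. Qed.

End FMean.

(** * The envelope *)

Lemma sup_compactP (R : realType) (Y : topologicalType) (K : set Y) (h : Y -> R) :
  compact K -> K !=set0 -> (forall y, K y -> {for y, continuous h}) ->
  (exists2 y, K y & sup [set h y | y in K] = h y) /\
  forall y, K y -> h y <= sup [set h y | y in K].
Proof.
move=> cK K0 ch; have [|y] := @compact_EVT_max _ _ h K K0 cK _.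
  by apply: continuous_in_subspaceT => y; rewrite inE; exact: ch.
rewrite inE => Ky hy.
have ub : ubound [set h y | y in K] (h y).
  by move=> _ [z Kz <-]; apply: hy; rewrite inE.
have hs : has_sup [set h y | y in K] by split; [exists (h y), y|exists (h y)].
have hle z : K z -> h z <= sup [set h y | y in K].
  by move=> Kz; apply: sup_upper_bound => //; exists z.
split=> //; exists y => //; apply/eqP; rewrite eq_le hle// andbT.
by apply: ge_sup => //; exists (h y), y.
Qed.

(** By compactness of [K], joint continuity makes [h x y] and [h z y] close uniformly in [y];
    comparing at the maximizers for [x] and [z] carries this over to the suprema. *)
Lemma sup_compact_continuous (R : realType) (X Y : topologicalType) (K : set Y)
    (h : X -> Y -> R) (x : X) (D : set X) : compact K -> K !=set0 -> nbhs x D ->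
  (forall x y, D x -> K y -> {for (x, y), continuous (fun p => h p.1 p.2)}) ->
  {for x, continuous (fun x => sup [set h x y | y in K])}.
Proof.
move=> cK K0 nD ch.
have chx z y : D z -> K y -> {for y, continuous (h z)}.
  by move=> Dz Ky; apply: continuous_uncurryr; exact: ch.
have Dx := nbhs_singleton nD.
apply/cvgrPdist_le => e e0.
have cov : \forall z \near x, K `<=` (fun y => `|h x y - h z y| <= e).
  have /compact_near_coveringP cK' := cK.
  apply: (cK' X (nbhs x) (fun z y => `|h x y - h z y| <= e)) => y Ky.
  have e20 : 0 < e / 2 by rewrite divr_gt0.
  have /cvgrPdist_lt/(_ _ e20)[[P Q] /= [nP nQ] PQ] := ch x y Dx Ky.
  exists (Q, P) => // -[y' z] [/= Qy Pz].
  have /= H1 := PQ (z, y') (conj Pz Qy).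
  have /= H2 := PQ (x, y') (conj (nbhs_singleton nP) Qy).
  rewrite (le_trans (ler_distD (h x y) _ _))// [e]splitr lerD// ltW//.
  by rewrite distrC.
near=> z.
have Dz : D z by near: z.
have Hz : K `<=` (fun y => `|h x y - h z y| <= e) by near: z.
have [[y Ky Ex] xub] := sup_compactP cK K0 (fun y Ky => chx x y Dx Ky).
have [[y' Ky' Ez] zub] := sup_compactP cK K0 (fun y Ky => chx z y Dz Ky).
have /ler_normlP[_ H1] := Hz _ Ky; have /ler_normlP[H2 _] := Hz _ Ky'.
have H3 := zub _ Ky; have H4 := xub _ Ky'.
by apply/ler_normlP; split; lra.
Unshelve. all: by end_near. Qed.

Section Extension.
Context {R : realType} {n : nat} (Om : set 'rV[R]_n) (T : \bar R).
Variable u : 'rV[R]_n -> R -> R.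
Hypotheses (oOm : open Om) (T0 : (0 < T)%E).
Hypothesis hucont : {within closure Om `*` Ico0 T, continuous (fun p => u p.1 p.2)}.
Hypothesis u_bdry : forall x t, bdry Om x -> Ico0 T t -> u x t = 0.

(* Extended by zero across the boundary and constantly to negative times, [u]
   becomes continuous on the open set R^n x (-oo, T), which removes all
   restrictions to subspaces from the construction of [env] below. *)
Definition ext0 x t : R := if `[< Om x >] then u x (Num.max t 0) else 0.

Lemma ext0E x t : Om x -> Ico0 T t -> ext0 x t = u x t.
Proof. by move=> Ox [t0 _]; rewrite /ext0 asboolT// max_l. Qed.

Lemma ext0_out x t : ~ Om x -> ext0 x t = 0.
Proof. by move=> Ox; rewrite /ext0 asboolF. Qed.

Lemma Ico0_max t : (t%:E < T)%E -> Ico0 T (Num.max t 0).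
Proof.
by move=> tT; split; [rewrite le_max lexx orbT | rewrite EFin_max gt_max tT].
Qed.

Lemma ext0_continuous x t : (t%:E < T)%E ->
  {for (x, t), continuous (fun p => ext0 p.1 p.2)}.
Proof.
move=> tT; apply/cvgrPdist_lt => e e0 /=.
have nT : nbhs t [set s | (s%:E < T)%E].
  by apply: open_nbhs_nbhs; split=> //; exact: open_ereal_lt.
have [Kx|Kx] := pselect (closure Om x); last first.
  exists (~` closure Om, setT).
    split; last exact: filterT.
    by apply: open_nbhs_nbhs; split => //; apply: closed_openC; exact: closed_closure.
  move=> -[y s] [/= Ky _]; rewrite !ext0_out ?subrr ?normr0//.
    by move=> /subset_closure.
  by move=> /subset_closure.
(* On the boundary both branches of [ext0] agree because [u] vanishes there, so a single bound below
   covers interior and boundary points. *)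
have Ex : ext0 x t = u x (Num.max t 0).
  rewrite /ext0; case: asboolP => // Ox; rewrite u_bdry//; last exact: Ico0_max.
  by split=> // /interior_subset.
have : \forall p \near within (closure Om `*` Ico0 T) (nbhs (x, Num.max t 0)),
    `|ext0 x t - u p.1 p.2| < e.
  have Kxt : (closure Om `*` Ico0 T) (x, Num.max t 0) by split => //; exact: Ico0_max.
  move/subspace_continuousP: hucont => /(_ _ Kxt)/cvgrPdist_lt/(_ _ e0).
  by rewrite /= Ex.
case=> -[P Q] /= [nP nQ] PQ.
have nQ' : nbhs t [set s | Q (Num.max s 0)].
  have : {for t, continuous (fun s : R => Num.max s 0)}.
    by apply: (@continuous_max _ _ id (fun=> 0)); [exact: cvg_id | exact: cvg_cst].
  by move=> /(_ Q); apply.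
have [Ox|Ox] := pselect (Om x).
  exists (P `&` Om, [set s | Q (Num.max s 0)] `&` [set s | (s%:E < T)%E]).
    by split; apply: filterI => //; apply: open_nbhs_nbhs.
  move=> -[y s] [/= [Py Oy] [Qs sT]]; rewrite [ext0 y s]/ext0 asboolT//.
  by apply: (PQ (y, _)) => //; split; [exact: subset_closure | exact: Ico0_max].
exists (P, [set s | Q (Num.max s 0)] `&` [set s | (s%:E < T)%E]).
  by split => //; apply: filterI.
move=> -[y s] [/= Py [Qs sT]].
have [Oy|Oy] := pselect (Om y); last by rewrite !ext0_out// subrr normr0.
rewrite [ext0 y s]/ext0 asboolT//.
by apply: (PQ (y, _)) => //; split; [exact: subset_closure | exact: Ico0_max].
Qed.

End Extension.

Lemma bounded_closure (R : realType) (V : normedModType R) (A : set V) :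
  bounded_set A -> bounded_set (closure A).
Proof.
move=> [M [Mreal HM]]; exists M; split=> // x Mx y Ay.
have cB : closed [set z : V | `|z| <= x].
  apply: (@preimage_closed _ _ (fun z : V => `|z|) [set r : R | r <= x]).
    by move=> z _; exact: norm_continuous.
  exact: closed_le.
have : closure A `<=` [set z : V | `|z| <= x].
  by rewrite closure_id in cB; rewrite cB; apply: closure_subset; exact: HM.
by apply.
Qed.

Lemma bounded_closure_compact (R : realType) (n : nat) (A : set 'rV[R]_n) :
  bounded_set A -> compact (closure A).
Proof.
move=> bA; apply: bounded_closed_compact; last exact: closed_closure.
exact: bounded_closure.
Qed.

Lemma convex_comb (R : realType) (n : nat) (Om : set 'rV[R]_n) (l : R) x y :
  convex_set (Om : set (convex_lmodType 'rV[R]_n)) -> 0 < l < 1 ->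
  Om x -> Om y -> Om ((1 - l) *: x + l *: y).
Proof.
move=> cO /andP[l0 l1] Ox Oy.
have := cO y x (Itv01 (ltW l0) (ltW l1)) (mem_set Oy) (mem_set Ox).
by rewrite inE addrC; exact: id.
Qed.

Section Envelope.
Context {R : realType} {n : nat} (a : \bar R) (F : R -> \bar R).
Hypotheses (hF : admissible a F) (hF2 : C2_on (Ioo0 a) (fine \o F)).
Hypothesis hF' : forall r, Ioo0 a r -> 0 < (fine \o F)^`() r.
Hypotheses (a0 : (0 < a)%E).
Hypothesis hF0 : F r @[r --> 0^'+] --> -oo%E.
Variables (Om : set 'rV[R]_n) (T : \bar R) (u : 'rV[R]_n -> R -> R) (l : R).
Hypothesis l01 : 0 < l < 1.
Hypotheses (oOm : open Om) (Om0 : Om !=set0) (bOm : bounded_set Om).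
Hypothesis cOm : convex_set (Om : set (convex_lmodType 'rV[R]_n)).
Hypothesis T0 : (0 < T)%E.
Hypothesis hucont : {within closure Om `*` Ico0 T, continuous (fun p => u p.1 p.2)}.
Hypothesis u_bdry : forall x t, bdry Om x -> Ico0 T t -> u x t = 0.
Hypothesis huA : forall t, Ico0 T t -> A_Omega Om a (u^~ t).

Local Notation ue := (ext0 Om u).

Definition opp_pt (x y : 'rV[R]_n) := l^-1 *: (x - (1 - l) *: y).

(* [opp_pt x y] is the [z] with [x = (1 - l) y + l z]. If it falls outside [Om]
   the zero extension makes [env_arg] vanish, so the supremum defining [env]
   may range over all [y] of the compact set [closure Om], independently of
   [x]. *)
Definition env_arg x t y := Fmean a F l (ue y t) (ue (opp_pt x y) t).

Definition env x t := sup [set env_arg x t y | y in closure Om].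

Let l0 : l != 0. Proof. by case/andP: l01 => l0 _; rewrite gt_eqF. Qed.

Lemma opp_ptK x y : (1 - l) *: y + l *: opp_pt x y = x.
Proof. by rewrite scalerA mulfV// scale1r addrC subrK. Qed.

Lemma opp_pt_comb y z : opp_pt ((1 - l) *: y + l *: z) y = z.
Proof. by rewrite /opp_pt addrAC subrr add0r scalerA mulVf// scale1r. Qed.

Lemma ext0_lt x t : (t%:E < T)%E -> ((ue x t)%:E < a)%E.
Proof.
move=> tT; rewrite /ext0; case: asboolP => // Ox.
by have [] := huA (Ico0_max T0 tT) (imageP _ Ox).
Qed.

Lemma closure_neq0 : closure Om !=set0.
Proof. by case: Om0 => x Ox; exists x; exact: subset_closure. Qed.

Lemma env_arg_continuous (x y : 'rV[R]_n) (t : R) : (t%:E < T)%E ->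
  {for ((x, t), y), continuous (fun p => env_arg p.1.1 p.1.2 p.2)}.
Proof.
move=> tT; have lt1 := ext0_lt y tT; have lt2 := ext0_lt (opp_pt x y) tT.
have cue z : {for (z, t), continuous (fun p => ue p.1 p.2)}.
  exact: (ext0_continuous oOm T0 hucont u_bdry tT).
have c11 : {for ((x, t), y), continuous (fun p : ('rV[R]_n * R) * 'rV[R]_n => p.1.1)}.
  by apply: (@continuous_comp _ _ _ fst fst); exact: cvg_fst.
have c12 : {for ((x, t), y), continuous (fun p : ('rV[R]_n * R) * 'rV[R]_n => p.1.2)}.
  by apply: (@continuous_comp _ _ _ fst snd); [exact: cvg_fst | exact: cvg_snd].
have c2 : {for ((x, t), y), continuous (fun p : ('rV[R]_n * R) * 'rV[R]_n => p.2)}.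
  exact: cvg_snd.
have copp : {for ((x, t), y), continuous
    (fun p : ('rV[R]_n * R) * 'rV[R]_n => opp_pt p.1.1 p.2)}.
  apply: cvgZ; first exact: cvg_cst.
  apply: cvgB; first exact: c11.
  by apply: cvgZ; [exact: cvg_cst | exact: c2].
apply: (continuous_comp2 (f := fun p => ue p.2 p.1.2)
  (g := fun p => ue (opp_pt p.1.1 p.2) p.1.2) (h := Fmean a F l)).
- by apply: (continuous_comp2 c2 c12); exact: cue.
- by apply: (continuous_comp2 copp c12); exact: cue.
- exact: (Fmean_continuous hF hF2 hF' a0 hF0 l01 lt1 lt2).
Qed.

Lemma env_arg_continuousr (x y : 'rV[R]_n) (t : R) : (t%:E < T)%E ->
  {for y, continuous (env_arg x t)}.
Proof.
move=> tT; exact: (continuous_uncurryr (h := fun p => env_arg p.1 p.2)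
  (env_arg_continuous (x := x) (y := y) tT)).
Qed.

Lemma env_continuous (x : 'rV[R]_n) (t : R) : (t%:E < T)%E ->
  {for (x, t), continuous (fun p => env p.1 p.2)}.
Proof.
move=> tT; apply: (sup_compact_continuous (D := [set p | (p.2%:E < T)%E])
   (h := fun p => env_arg p.1 p.2) (bounded_closure_compact bOm) closure_neq0).
  exists (setT, [set s | (s%:E < T)%E]); last by move=> ? [].
  split; first exact: filterT.
  by apply: open_nbhs_nbhs; split=> //; exact: open_ereal_lt.
by move=> [x' t'] y' t'T _; exact: env_arg_continuous.
Qed.

Lemma env_ge x t y : (t%:E < T)%E -> closure Om y -> env_arg x t y <= env x t.
Proof.
move=> tT; have [_] := sup_compactP (bounded_closure_compact bOm) closure_neq0
  (fun y _ => env_arg_continuousr (x := x) (y := y) tT).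
by apply.
Qed.

Lemma env_attained x t : (t%:E < T)%E ->
  exists2 y, closure Om y & env x t = env_arg x t y.
Proof.
move=> tT; have [+ _] := sup_compactP (bounded_closure_compact bOm) closure_neq0
  (fun y _ => env_arg_continuousr (x := x) (y := y) tT).
by [].
Qed.

Lemma env_ge0 x t : (t%:E < T)%E -> 0 <= env x t.
Proof.
by move=> tT; have [y _ ->] := env_attained x tT; apply: (Fmean_ge0 hF hF2);
  rewrite ?ext0_lt.
Qed.

Lemma env_comb_ge y z t : Ico0 T t -> Om y -> Om z ->
  Fmean a F l (u y t) (u z t) <= env ((1 - l) *: y + l *: z) t.
Proof.
move=> tT Oy Oz; rewrite -(ext0E u Oy tT) -(ext0E u Oz tT).
rewrite -{1}(opp_pt_comb y z); apply: env_ge; first by case: tT.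
exact: subset_closure.
Qed.

(** A positive mean has two positive arguments, and [ext0] vanishes off [Om]; so a maximizer on the
    boundary is excluded. *)
Lemma env_gt0_attained x t : Ico0 T t -> 0 < env x t -> exists y z,
  [/\ Om y, Om z, x = (1 - l) *: y + l *: z &
   [/\ Ioo0 a (u y t), Ioo0 a (u z t) & env x t = Fmean a F l (u y t) (u z t)]].
Proof.
move=> tT; have [y Ky ->] := env_attained x tT.2 => /[dup] /Fmean_gt0.
have ue_gt0 z : 0 < ue z t -> Om z /\ Ioo0 a (u z t).
  rewrite /ext0; case: asboolP; rewrite ?ltxx// max_l; last by case: tT.
  by move=> Oz uz; split=> //; split=> //; have [] := huA tT (imageP _ Oz).
move=> [/ue_gt0[Oy ay] /ue_gt0[Oz az]] _; exists y, (opp_pt x y).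
by rewrite opp_ptK /env_arg (ext0E u Oy tT) (ext0E u Oz tT).
Qed.

(** A positive value would exhibit [x] as a convex combination of two points of [Om]. *)
Lemma env_out x t : Ico0 T t -> ~ Om x -> env x t = 0.
Proof.
move=> tT Ox; apply/eqP; rewrite eq_le env_ge0 ?andbT; last by case: tT.
rewrite leNgt; apply/negP => /(env_gt0_attained tT) [y [z [Oy Oz xE _]]].
by apply: Ox; rewrite xE; exact: convex_comb.
Qed.

(** The choice [y = z = x] competes in the supremum; this makes the envelope positive wherever [u]
    is. *)
Lemma env_ge_id x t : Om x -> Ico0 T t -> 0 < u x t -> u x t <= env x t.
Proof.
move=> Ox tT u0.
have au : Ioo0 a (u x t) by split=> //; have [] := huA tT (imageP _ Ox).
have := env_comb_ge tT Ox Ox; rewrite -scalerDl subrK scale1r.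
by rewrite Fmean_id.
Qed.

End Envelope.

(** * The viscosity inequality *)

Lemma concave_comb (R : realType) (E : lmodType R) (D : set E) (h : E -> R)
    (l : R) (p q : E) : concave_on D h -> 0 < l < 1 -> D p -> D q ->
  (1 - l) * h p + l * h q <= h ((1 - l) *: p + l *: q).
Proof.
move=> hD /andP[l0 l1] Dp Dq.
(* [convex_function] puts the weight [l] on its first point, hence the exchanged order. *)
have : - h (l *: q + (1 - l) *: p) <= l * - h q + (1 - l) * - h p.
  exact: (hD (Itv01 (ltW l0) (ltW l1)) q p (mem_set Dq) (mem_set Dp)).
by rewrite [l *: q + _]addrC => H; lra.
Qed.

Section C21Facts.
Context {R : realType} {n : nat} (Om : set 'rV[R]_n) (T : \bar R).
Variable psi : 'rV[R]_n -> R -> R.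
Hypotheses (oOm : open Om) (psi2 : C21 Om T psi).

Lemma nbhs_cylinder (x : 'rV[R]_n) (t : R) : Om x -> Ioo0 T t ->
  nbhs (x, t) (Om `*` Ioo0 T).
Proof.
move=> Ox tT; exists (Om, Ioo0 T) => //.
by split; apply: open_nbhs_nbhs => //; split=> //; exact: open_Ioo0.
Qed.

Lemma within_cylinder_continuous (f : 'rV[R]_n * R -> R) (x : 'rV[R]_n) (t : R) :
  Om x -> Ioo0 T t -> {within Om `*` Ioo0 T, continuous f} ->
  {for (x, t), continuous f}.
Proof.
move=> Ox tT; rewrite continuous_open_subspace; first by apply; rewrite inE.
by rewrite openE => -[y s] [Oy sT]; exact: nbhs_cylinder.
Qed.

Lemma C21_continuous (x : 'rV[R]_n) (t : R) : Om x -> Ioo0 T t ->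
  {for (x, t), continuous (fun p => psi p.1 p.2)}.
Proof.
by move=> Ox tT; apply: within_cylinder_continuous => //; case: psi2.
Qed.

Lemma C21_C2_at (x : 'rV[R]_n) (t : R) : Om x -> Ioo0 T t -> C2_at (psi^~ t) x.
Proof.
move=> Ox tT; have [dpsi _ c1 c2 _] := psi2.
have nOm y : Om y -> \forall z \near y, Om z.
  by move=> Oy; apply: open_nbhs_nbhs.
split=> [|j].
  apply: filterS (nOm x Ox) => y Oy i; split.
    by apply: filterS (nOm y Oy) => z Oz; case: (dpsi z t Oz tT) => d _ _; exact: d.
  apply: (continuous_curryl (h := fun y t => pd i (psi^~ t) y)).
  exact: within_cylinder_continuous (c1 i).
move=> i; split.
  by apply: filterS (nOm x Ox) => y Oy; case: (dpsi y t Oy tT) => _ d _; exact: d.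
apply: (continuous_curryl (h := fun y t => pd i (pd j (psi^~ t)) y)).
exact: within_cylinder_continuous (c2 i j).
Qed.

End C21Facts.

(** * Matrix pairings and the values of H *)

Section MatrixForms.
Context {R : realType} {n : nat}.

(** The Frobenius inner product, a common form for traces, quadratic forms and the second-order sum
    of the equation. *)
Definition mxdot (A M : 'M[R]_n) := \sum_i \sum_j A i j * M i j.

Lemma mxtrace_mxdot (A M : 'M[R]_n) : A^T = A -> \tr (A *m M) = mxdot A M.
Proof.
move=> symA; rewrite /mxdot exchange_big; apply: eq_bigr => i _.
by rewrite mxE; apply: eq_bigr => j _; rewrite -{1}symA mxE.
Qed.

Lemma dot_mxact (A : 'M[R]_n) (v : 'rV[R]_n) :
  dot (mxact A v) v = mxdot A (v^T *m v).
Proof.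
apply: eq_bigr => i _; rewrite /mxact mxE mulr_suml; apply: eq_bigr => j _.
by rewrite !mxE big_ord1 !mxE; ring.
Qed.

Definition sym_part (M : 'M[R]_n) : 'M[R]_n := 2^-1 *: (M + M^T).

Lemma sym_part_sym M : (sym_part M)^T = sym_part M.
Proof. by rewrite /sym_part linearZ/= linearD/= trmxK addrC. Qed.

(** A symmetric [A] pairs equally with [M] and its transpose. *)
Lemma mxdot_sym_part (A M : 'M[R]_n) : A^T = A ->
  mxdot A (sym_part M) = mxdot A M.
Proof.
move=> symA.
have E : mxdot A M^T = mxdot A M.
  rewrite /mxdot exchange_big; apply: eq_bigr => i _; apply: eq_bigr => j _.
  by rewrite -{1}symA !mxE.
have -> : mxdot A (sym_part M) = 2^-1 * (mxdot A M + mxdot A M^T).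
  rewrite /mxdot -big_split /= mulr_sumr; apply: eq_bigr => i _.
  rewrite -big_split /= mulr_sumr; apply: eq_bigr => j _.
  by rewrite /sym_part !mxE; ring.
by rewrite E; lra.
Qed.

Lemma mxdotD (A M N : 'M[R]_n) : mxdot A (M + N) = mxdot A M + mxdot A N.
Proof.
rewrite /mxdot -big_split /=; apply: eq_bigr => i _.
by rewrite -big_split /=; apply: eq_bigr => j _; rewrite mxE mulrDr.
Qed.

Lemma mxdotZ (A M : 'M[R]_n) (c : R) : mxdot A (c *: M) = c * mxdot A M.
Proof.
rewrite /mxdot mulr_sumr; apply: eq_bigr => i _.
by rewrite mulr_sumr; apply: eq_bigr => j _; rewrite mxE; ring.
Qed.

End MatrixForms.

Section EvalH.
Context {R : realType} {n : nat} (a : \bar R) (F : R -> \bar R).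
Hypotheses (hF : admissible a F) (hF2 : C2_on (Ioo0 a) (fine \o F)).
Hypothesis hF' : forall r, Ioo0 a r -> 0 < (fine \o F)^`() r.

(* With V = F(v) and th = grad V, the equation for v reads
   dV/dt = tr(A D^2 V) + G / f' + (f'' / f') <A th, th>. Evaluating H at
   M = D^2 V + th (x) th absorbs the summand - <A th, th> of H. The Hessian is
   symmetrized instead of proving that mixed derivatives commute. *)
Lemma calH_eval (A : 'rV[R]_n -> R -> 'M[R]_n)
    (G : 'rV[R]_n -> R -> R -> 'rV[R]_n -> R) (v : 'rV[R]_n -> R -> R)
    (x : 'rV[R]_n) (t : R) (th : 'rV[R]_n) :
  (A x t)^T = A x t -> Ioo0 a (v x t) ->
  th = (fine \o F)^`()%classic (v x t) *: grad (v^~ t) x ->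
  calH A G a F th t (x, (fine \o F) (v x t),
    sym_part (hess_comp (fine \o F) (v^~ t) x) + th^T *m th) =
  (fine \o F)^`()%classic (v x t) * rhsN A G v x t.
Proof.
move=> symA av thE; rewrite /calH /= mxtrace_mxdot// dot_mxact.
rewrite -[fine (F (v x t))]/((fine \o F) (v x t)) fF_derive1// fF_derive2// fFK//.
set g1 : R := _^`()%classic (v x t) in thE *.
set g2 : R := _^`()%classic (v x t).
have g0 : g1 != 0 by rewrite gt_eqF// hF'.
(* The derivative of [fF] is [g1^-1] here, so [G] receives the gradient of [v] itself. *)
have -> : g1^-1 *: th = grad (v^~ t) x by rewrite thE scalerA mulVf// scale1r.
pose D2 : 'M[R]_n := \matrix_(i, j) pd i (pd j (v^~ t)) x.
pose P := (grad (v^~ t) x)^T *m grad (v^~ t) x.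
have thP : th^T *m th = g1 ^+ 2 *: P.
  by apply/matrixP => i j; rewrite thE !mxE !big_ord1 !mxE; ring.
have hE : hess_comp (fine \o F) (v^~ t) x = g1 *: D2 + g2 *: P.
  by apply/matrixP => i j; rewrite !mxE big_ord1 !mxE.
rewrite mxdotD mxdot_sym_part// thP hE !mxdotD !mxdotZ /rhsN.
have -> : \sum_i \sum_j A x t i j * pd i (pd j (v^~ t)) x = mxdot (A x t) D2.
  by apply: eq_bigr => i _; apply: eq_bigr => j _; rewrite mxE.
(* Since [f'' / f' = - g2 / g1 ^+ 2], the total coefficient of [mxdot (A x t) P] is [g2 + g1 ^+ 2 +
   (- g2 / g1 ^+ 2 - 1) * g1 ^+ 2 = 0]. *)
move: (mxdot _ _) (mxdot _ _) (G _ _ _ _) => X Y Z.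
by rewrite invrK; field.
Qed.

End EvalH.

Section MatrixPositivity.
Context {R : realType} {n : nat}.
Implicit Types (A M : 'M[R]_n) (v : 'rV[R]_n).

Lemma qform_mxdot M v : qform M v = mxdot (v^T *m v) M.
Proof.
apply: eq_bigr => i _; apply: eq_bigr => j _.
by rewrite !mxE big_ord1 !mxE.
Qed.

Lemma qform_mulmx M v : qform M v = (v *m M *m v^T) 0 0.
Proof.
rewrite mxE /qform exchange_big /=; apply: eq_bigr => j _.
by rewrite !mxE mulr_suml; apply: eq_bigr => i _; ring.
Qed.

Lemma dot_gt0 v : v != 0 -> 0 < dot v v.
Proof.
move=> v0; rewrite lt_neqAle sumr_ge0 ?andbT => [|i _]; last by rewrite -expr2 sqr_ge0.
apply: contra_neq v0 => /esym /psumr_eq0P v0; apply/rowP => i.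
by rewrite mxE; apply/eqP; rewrite -[_ == 0]orbb -mulf_eq0 v0// => j _;
  rewrite -expr2 sqr_ge0.
Qed.

Lemma elliptic_trace_ge0 A M (L : R) : A^T = A -> 0 < L ->
  (forall v, L^-1 * dot v v <= dot (mxact A v) v) ->
  (forall v, 0 <= qform M v) -> 0 <= \tr (A *m M).
Proof.
move=> symA L0 ellA Mge0; apply: trace_posdef_ge0 => // v; last first.
  by rewrite -qform_mulmx.
move=> v0; rewrite -qform_mulmx.
have -> : qform A v = dot (mxact A v) v.
  rewrite dot_mxact qform_mxdot /mxdot; apply: eq_bigr => i _.
  by apply: eq_bigr => j _; rewrite mulrC.
by apply: lt_le_trans (ellA v); rewrite mulr_gt0 ?invr_gt0 ?dot_gt0.
Qed.

End MatrixPositivity.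

Lemma comb_triple {R : realType} {n : nat} (l : R) (y z : 'rV[R]_n) (q r : R^o)
    (M N : 'M[R]_n) : (1 - l) *: (y, q, M) + l *: (z, r, N) =
  ((1 - l) *: y + l *: z, ((1 - l) * q + l * r : R^o), (1 - l) *: M + l *: N).
Proof. by []. Qed.

(** The weights add up to 1, so the common summand [Q], later [th^T *m th], cancels. *)
Lemma sym_part_comb3 {R : realType} {n : nat} (l : R) (M N P Q : 'M[R]_n) :
  sym_part M + Q - ((1 - l) *: (sym_part N + Q) + l *: (sym_part P + Q)) =
  sym_part (M - (1 - l) *: N - l *: P).
Proof. by apply/matrixP => i j; rewrite !mxE; ring. Qed.

Section Viscosity.
Context {R : realType} {n : nat} (a : \bar R) (F : R -> \bar R).
Hypotheses (a0 : (0 < a)%E) (hF : admissible a F).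
Variables (Om : set 'rV[R]_n) (T : \bar R).
Hypotheses (hOm : smooth_bounded_convex_domain Om) (T0 : (0 < T)%E).
Variables (A : 'rV[R]_n -> R -> 'M[R]_n) (G : 'rV[R]_n -> R -> R -> 'rV[R]_n -> R).
Hypothesis hA : coefficients_ok Om T A.
Hypothesis hF0 : F r @[r --> 0^'+] --> -oo%E.
Hypothesis hF2 : C2_on (Ioo0 a) (fine \o F).
Hypothesis hF' : forall r, Ioo0 a r -> 0 < (fine \o F)^`() r.
Hypothesis hH : forall (theta : 'rV[R]_n) (t : R), Ioo0 T t ->
  concave_on (domH Om a F) (calH A G a F theta t).
Variables (phi : 'rV[R]_n -> R) (u : 'rV[R]_n -> R -> R).
Hypothesis hu : classical_solution Om T A G phi u.
Hypothesis hucont : {within closure Om `*` Ico0 T, continuous (fun p => u p.1 p.2)}.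
Hypothesis huA : forall t, Ico0 T t -> A_Omega Om a (u^~ t).
Variable l : R.
Hypothesis l01 : 0 < l < 1.

Local Notation g := (fine \o F).
Local Notation w := (env a F Om u l).

Let oOm := dom_open hOm.
Let Om0 := dom_nonempty hOm.
Let bOm := dom_bounded hOm.
Let cOm := dom_convex hOm.
Let u_bdry := sol_bdry hu.

Let sol_Ioo0 x t : Om x -> Ioo0 T t -> Ioo0 a (u x t).
Proof.
move=> Ox tT; split; first exact: sol_gt0 hu _ _ Ox tT.
by have [] := huA (Ioo0_Ico0 tT) (imageP _ Ox).
Qed.

Let w_continuous (x : 'rV[R]_n) (t : R) : (t%:E < T)%E ->
  {for (x, t), continuous (fun p => w p.1 p.2)}.
Proof.
exact: (env_continuous hF hF2 hF' a0 hF0 l01 oOm Om0 bOm T0 hucont u_bdry huA).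
Qed.

Let w_comb_ge y z t : Ico0 T t -> Om y -> Om z ->
  Fmean a F l (u y t) (u z t) <= w ((1 - l) *: y + l *: z) t.
Proof.
exact: (env_comb_ge hF hF2 hF' a0 hF0 l01 oOm Om0 bOm T0 hucont u_bdry huA).
Qed.

Let w_gt0 x t : Om x -> Ioo0 T t -> 0 < w x t.
Proof.
move=> Ox tT; have u0 := sol_gt0 hu Ox tT; apply: (lt_le_trans u0).
exact: (env_ge_id hF hF2 hF' a0 hF0 l01 oOm Om0 bOm T0 hucont u_bdry huA Ox
  (Ioo0_Ico0 tT) u0).
Qed.

Section Touch.
Variables (psi : 'rV[R]_n -> R -> R) (xi : 'rV[R]_n) (tau : R).
Hypotheses (Oxi : Om xi) (tauT : Ioo0 T tau) (psi2 : C21 Om T psi).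
Hypothesis psi_eq : psi xi tau = w xi tau.
Hypothesis psi_ge : \forall q \near within (Om `*` Ioo0 T) (nbhs (xi, tau)),
  w q.1 q.2 <= psi q.1 q.2.
Variables y z : 'rV[R]_n.
Hypotheses (Oy : Om y) (Oz : Om z) (xiE : xi = (1 - l) *: y + l *: z).
Hypothesis wE : w xi tau = Fmean a F l (u y tau) (u z tau).

Let ay := sol_Ioo0 Oy tauT.
Let az := sol_Ioo0 Oz tauT.

Let ap : Ioo0 a (psi xi tau).
Proof. by rewrite psi_eq wE; case: (Fmean_pos hF hF2 l01 ay az). Qed.

Let gp : g (psi xi tau) = (1 - l) * g (u y tau) + l * g (u z tau).
Proof. by rewrite psi_eq wE; case: (Fmean_pos hF hF2 l01 ay az). Qed.

(** The second condition keeps [psi] in the range where the monotonicity of [g] can be used. *)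
Let good x t := w x t <= psi x t /\ Ioo0 a (psi x t).

Let good_near : \forall p \near (xi, tau), good p.1 p.2.
Proof.
have cyl := nbhs_cylinder oOm Oxi tauT.
have H1 : \forall p \near (xi, tau), w p.1 p.2 <= psi p.1 p.2.
  by move: psi_ge; rewrite near_withinE => H; apply: filterS2 cyl H => p Qp; apply.
have H2 : \forall p \near (xi, tau), Ioo0 a (psi p.1 p.2).
  by have /(_ _ (adm_near ap)) := C21_continuous oOm psi2 Oxi tauT.
by apply: filterS2 H1 H2 => p; split.
Qed.

(** The mean of the two values of [u] is at most [w], hence at most [psi]; applying the increasing
    [g] linearizes the mean. *)
Let above y' z' t : Om y' -> Om z' -> Ioo0 T t ->
  good ((1 - l) *: y' + l *: z') t ->
  (1 - l) * g (u y' t) + l * g (u z' t) <= g (psi ((1 - l) *: y' + l *: z') t).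
Proof.
move=> Oy' Oz' tT [wpsi ap'].
have [am <-] := Fmean_pos hF hF2 l01 (sol_Ioo0 Oy' tT) (sol_Ioo0 Oz' tT).
rewrite (adm_le hF)//; apply: le_trans wpsi.
by apply: w_comb_ge => //; exact: Ioo0_Ico0.
Qed.

Let nOm x : Om x -> \forall x' \near x, Om x'.
Proof. by move=> Ox; apply: open_nbhs_nbhs. Qed.

Let above_space (v v' : 'rV[R]_n) : \forall s \near (0 : R),
  (1 - l) * g (u (y + s *: v) tau) + l * g (u (z + s *: v') tau) <=
  g (psi (xi + s *: ((1 - l) *: v + l *: v')) tau).
Proof.
have good_xi : \forall x \near xi, good x tau.
  have [[B C] /= [nB nC] BC] := good_near.
  by apply: filterS nB => x Bx; apply: (BC (x, tau)); split=> //; exact: nbhs_singleton nC.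
apply: filterS3 (near_line ((1 - l) *: v + l *: v') good_xi)
  (near_line v (nOm Oy)) (near_line v' (nOm Oz)) => s.
have -> : xi + s *: ((1 - l) *: v + l *: v') =
    (1 - l) *: (y + s *: v) + l *: (z + s *: v').
  by apply/rowP => i; rewrite xiE !mxE; ring.
by move=> goods Oys Ozs; exact: above.
Qed.

(** With [y] and [z] fixed, the combined point stays at [xi] for all [t]. The gap then has an
    interior minimum in time at [tau], so its derivative vanishes. *)
Let above_time : g^`()%classic (psi xi tau) * (psi xi)^`()%classic tau =
  (1 - l) * (g^`()%classic (u y tau) * (u y)^`()%classic tau)
  + l * (g^`()%classic (u z tau) * (u z)^`()%classic tau).
Proof.
have D (v : 'rV[R]_n -> R -> R) x : C21 Om T v -> Om x -> Ioo0 a (v x tau) ->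
    is_derive tau 1 (fun t => g (v x t))
      (g^`()%classic (v x tau) * (v x)^`()%classic tau).
  move=> v2 Ox av; apply: is_derive1_comp_derive1.
    by have [] := hF2.1 _ av.
  rewrite derive1E; apply/derivableP.
  by have [/(_ x tau Ox tauT)[]] := v2.
have Dk := is_derive_comb3 (1 - l) l (D _ _ psi2 Oxi ap)
  (D _ _ (sol_C21 hu) Oy ay) (D _ _ (sol_C21 hu) Oz az).
suff ge0 : \forall t \near tau,
    0 <= g (psi xi t) - (1 - l) * g (u y t) - l * g (u z t).
  suff E : g^`()%classic (psi xi tau) * (psi xi)^`()%classic tau -
      (1 - l) * (g^`()%classic (u y tau) * (u y)^`()%classic tau) -
      l * (g^`()%classic (u z tau) * (u z)^`()%classic tau) = 0 by lra.
  apply: (local_min_derive0 Dk); apply: filterS ge0 => t; apply: le_trans.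
  by rewrite gp addrAC addrK subrr.
have [[B C] /= [nB nC] BC] := good_near.
apply: filterS2 nC (adm_near tauT) => t Ct tT.
have := above Oy Oz tT; rewrite -xiE => /(_ (BC (xi, t) _)) H.
suff : (1 - l) * g (u y t) + l * g (u z t) <= g (psi xi t) by move=> /= ?; lra.
by apply: H; split=> //; exact: nbhs_singleton nB.
Qed.

(** The common gradient of [F(psi)] at [xi] and of [F(u)] at [y] and [z]; it serves as the parameter
    theta of H. *)
Let th : 'rV[R]_n := g^`()%classic (psi xi tau) *: grad (psi^~ tau) xi.
Let hess v x : 'M[R]_n := hess_comp g (v^~ tau) x.

Let p2 := C21_C2_at oOm psi2 Oxi tauT.
Let uy2 := C21_C2_at oOm (sol_C21 hu) Oy tauT.
Let uz2 := C21_C2_at oOm (sol_C21 hu) Oz tauT.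

Let th_y : th = g^`()%classic (u y tau) *: grad (u^~ tau) y.
Proof.
apply/rowP => i; rewrite !mxE.
by have [-> _] := touching_grad l01 p2 uy2 uz2 (adm_C2 hF2 ap) (adm_C2 hF2 ay)
  (adm_C2 hF2 az) gp above_space i.
Qed.

Let th_z : th = g^`()%classic (u z tau) *: grad (u^~ tau) z.
Proof.
apply/rowP => i; rewrite !mxE.
by have [_ ->] := touching_grad l01 p2 uy2 uz2 (adm_C2 hF2 ap) (adm_C2 hF2 ay)
  (adm_C2 hF2 az) gp above_space i.
Qed.

Let trace_hess_ge0 : 0 <=
  \tr (A xi tau *m (hess psi xi - (1 - l) *: hess u y - l *: hess u z)).
Proof.
have tauT' := Ioo0_Ico0 tauT.
have symA := coef_sym hA Oxi tauT'; have [L L0 ellA] := coef_elliptic hA.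
apply: (elliptic_trace_ge0 symA L0) => v.
  by have /andP[] := ellA xi tau v Oxi tauT'.
rewrite qform_mxdot -!scaleNr !mxdotD !mxdotZ -!qform_mxdot !mulNr.
exact: (touching_hess p2 uy2 uz2 (adm_C2 hF2 ap) (adm_C2 hF2 ay)
  (adm_C2 hF2 az) gp above_space).
Qed.

Lemma touching_subsolution : (psi xi)^`()%classic tau <= rhsN A G psi xi tau.
Proof.
have tauT' := Ioo0_Ico0 tauT.
have symA x : Om x -> (A x tau)^T = A x tau by move=> Ox; exact: coef_sym hA _ _ Ox tauT'.
pose M v x := sym_part (hess v x) + th^T *m th.
have symM v x : (M v x)^T = M v x.
  by rewrite /M linearD/= sym_part_sym trmx_mul trmxK.
have dom v x : Om x -> Ioo0 a (v x tau) ->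
    domH Om a F (x, g (v x tau) : R^o, M v x).
  by move=> Ox av; split=> //=; exists (v x tau).
(* The first two components of the combined point are exactly [xi] and [g (psi xi tau)]; only its
   matrix differs from [M psi xi]. *)
have conc := concave_comb (hH th tauT) l01 (dom u y Oy ay) (dom u z Oz az).
rewrite comb_triple -xiE -gp in conc.
have Ey : calH A G a F th tau (y, g (u y tau) : R^o, M u y) =
    g^`()%classic (u y tau) * rhsN A G u y tau.
  exact: (calH_eval hF hF2 hF' G (symA y Oy) ay th_y).
have Ez : calH A G a F th tau (z, g (u z tau) : R^o, M u z) =
    g^`()%classic (u z tau) * rhsN A G u z tau.
  exact: (calH_eval hF hF2 hF' G (symA z Oz) az th_z).
have Exi : calH A G a F th tau (xi, g (psi xi tau) : R^o, M psi xi) =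
    g^`()%classic (psi xi tau) * rhsN A G psi xi tau.
  exact: (calH_eval hF hF2 hF' G (symA xi Oxi) ap (erefl : th = _)).
(* After multiplication by the positive derivative of [g], the time identity and the equations at
   [y] and [z] express both sides by values of H. *)
rewrite -(ler_pM2l (hF' ap)) -Exi above_time.
rewrite (sol_eq hu Oy tauT) (sol_eq hu Oz tauT) -Ey -Ez.
apply: le_trans conc _.
(* All terms but the traces coincide, and the difference of the traces is that of [trace_hess_ge0],
   up to symmetrization. *)
rewrite /calH /= !lerD2r -subr_ge0 -raddfB/= -mulmxBr.
rewrite sym_part_comb3.
by rewrite mxtrace_mxdot ?symA// mxdot_sym_part ?symA// -mxtrace_mxdot ?symA//.
Qed.
End Touch.

Lemma env_viscosity_subsolution : viscosity_subsolution Om T A G w.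
Proof.
split=> [x t Ox tT|x t Ox tT c wc|xi tau psi Oxi tauT psi2 psi_eq psi_ge].
- exact: w_gt0.
- have [_ tltT] := tT; have /cvgr_lt/(_ c wc) := w_continuous (x := x) tltT.
  by apply: cvg_within.
- have tauT' := Ioo0_Ico0 tauT.
  (* Positivity of [w] places [y] and [z] inside [Om], where the equation for [u] holds. *)
  have [y [z [Oy Oz xiE [_ _ wE]]]] :=
    env_gt0_attained hF hF2 hF' a0 hF0 l01 oOm Om0 bOm T0 hucont u_bdry huA
      tauT' (w_gt0 Oxi tauT).
  exact: (touching_subsolution Oxi tauT psi2 psi_eq psi_ge Oy Oz xiE wE).
Qed.

(** * Comparison of the envelope with the solution *)

Hypothesis hphi : C_Omega Om a F phi.
Hypothesis hWCP : WCP Om T A G.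

Lemma env_le_sol x t : closure Om x -> Ico0 T t -> w x t <= u x t.
Proof.
have T0' : Ico0 T 0 by [].
have u_ge0 x' t' : closure Om x' -> Ico0 T t' -> 0 <= u x' t'.
  move=> Kx tT; have [Ox|Ox] := pselect (Om x').
    by have [] := huA tT (imageP _ Ox).
  by rewrite u_bdry//; split=> // /interior_subset.
have w_out x' t' : Ico0 T t' -> ~ Om x' -> w x' t' = 0.
  exact: (env_out hF hF2 hF' a0 hF0 l01 oOm Om0 bOm cOm T0 hucont u_bdry huA).
apply: (hWCP hucont _ hu env_viscosity_subsolution).
- apply: continuous_in_subspaceT => -[x' t']; rewrite inE => -[_ [_ t'T]].
  exact: w_continuous.
(* At time 0 a positive value of [w] is attained at two points of [Om], where the F-concavity of
   [phi] applies. *)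
- move=> x' Kx; have [w0|w0] := leP (w x' 0) 0.
    exact: le_trans w0 (u_ge0 _ _ Kx T0').
  have [y [z [Oy Oz xE [ay az wE]]]] :=
    env_gt0_attained hF hF2 hF' a0 hF0 l01 oOm Om0 bOm T0 hucont u_bdry huA
      T0' w0.
  have [am gm] := Fmean_pos hF hF2 l01 ay az.
  have Ox : Om x' by rewrite xE; exact: convex_comb.
  have := hphi.2 y z l Oy Oz l01; rewrite -xE.
  rewrite -!(sol_init hu)// (admE hF ay) (admE hF az) -!EFinM -EFinD -gm -(admE hF am).
  rewrite -wE => Fle; rewrite leNgt; apply/negP => uw.
  have aw : Ico0 a (w x' 0) by rewrite wE; exact: Ioo0_Ico0.
  (* Strict monotonicity on [[0, a)] is used here because [u x' 0] may be 0, where [F] is [-oo]. *)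
  have := adm_incr hF (huA T0' (imageP (u^~ 0) Ox)) aw uw.
  by rewrite ltNge Fle.
- move=> x' t' bx tT; split; first exact: u_bdry.
  apply: w_out => // Ox; case: bx => _; apply.
  by rewrite (interior_id _).1.
Qed.

(** For [t > 0] all values of [u] in [Om] are positive, so the inequality can be read through the
    real-valued [g]. *)
Lemma sol_comb_le y z t : Om y -> Om z -> Ioo0 T t ->
  ((1 - l)%:E * F (u y t) + l%:E * F (u z t)
    <= F (u ((1 - l) *: y + l *: z) t))%E.
Proof.
move=> Oy Oz tT; have Ox := convex_comb cOm l01 Oy Oz.
have [ay az ax] := And3 (sol_Ioo0 Oy tT) (sol_Ioo0 Oz tT) (sol_Ioo0 Ox tT).
have [am gm] := Fmean_pos hF hF2 l01 ay az.
rewrite (admE hF ay) (admE hF az) (admE hF ax) -!EFinM -EFinD lee_fin -gm.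
rewrite (adm_le hF)//; have tT' := Ioo0_Ico0 tT.
apply: le_trans (w_comb_ge tT' Oy Oz) (env_le_sol _ tT').
exact: subset_closure.
Qed.

End Viscosity.

Unset Implicit Arguments.

Theorem proposition4p2 (R : realType) (n : nat) (hn : (0 < n)%N)
  (a : \bar R) (ha : (0 < a)%E) (F : R -> \bar R) (hF : admissible a F)
  (Om : set 'rV[R]_n) (hOm : smooth_bounded_convex_domain Om)
  (T : \bar R) (hT : (0 < T)%E)
  (A : 'rV[R]_n -> R -> 'M[R]_n) (hA : coefficients_ok Om T A)
  (G : 'rV[R]_n -> R -> R -> 'rV[R]_n -> R) (hG : nonlinearity_ok Om T G)
  (hF0 : F r @[r --> 0^'+] --> -oo%E)
  (hF2 : C2_on (Ioo0 a) (fine \o F))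
  (hF' : forall r, Ioo0 a r -> 0 < (fine \o F)^`() r)
  (hH : forall (theta : 'rV[R]_n) (t : R), Ioo0 T t ->
     concave_on (domH Om a F) (calH A G a F theta t))
  (hWCP : WCP Om T A G)
  (phi : 'rV[R]_n -> R) (hphi : C_Omega Om a F phi) (hphi0 : BC0 Om phi)
  (u : 'rV[R]_n -> R -> R) (hu : classical_solution Om T A G phi u)
  (hucont : {within closure Om `*` Ico0 T, continuous (fun p => u p.1 p.2)})
  (huA : forall t, Ico0 T t -> A_Omega Om a (u^~ t)) :
  forall t, Ico0 T t -> C_Omega Om a F (u^~ t).
Proof.
move=> t tT; split; first exact: huA.
move=> x y l Ox Oy l01; have [t0 t_lt] := tT.
(* Initial values may vanish, so [t = 0] is treated apart: there the claim is the F-concavity of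
   [phi]. *)
have [t00|t_le0] := ltP 0 t.
  exact: (sol_comb_le ha hF hOm hT hA hF0 hF2 hF' hH hu hucont huA l01 hphi
    hWCP Ox Oy (conj t00 t_lt)).
have {t0 t_le0} t0 : t = 0 by apply/eqP; rewrite eq_le t_le0.
rewrite t0 !(sol_init hu)//; first exact: hphi.2.
exact: convex_comb (dom_convex hOm) l01 Ox Oy.
Qed.
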